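(* There holds $$\widetilde{W}_{d,m}([1^{d'-i},i];(d),[1^{d-j},j])=\frac{|\mathcal{C}_{[1^{d-j},j]}|\,d^{\,d'-i-1}}{m!}\sum_{k=0}^{d-1}(-1)^k\Big[(d-k-\tfrac12)^i-(-k-\tfrac12)^i\Big]\Big[\binom{d-j-1}{k}+\binom{d-j-1}{k-j}\Big]\binom{d-k-1}{d-m}.$$
   Context: Here $d,d'\ge1$, $1\le m\le d$, and $[1^{d-j},j]$ denotes the partition of $d$ with one part $j$ and $d-j$ further parts equal to 1 (so $[1^{d-1},1]=[1^d]$), and similarly $[1^{d'-i},i]$ is a partition of $d'$. $\mathcal{C}_\lambda$ is the conjugacy class of cycle type $\lambda$ in the symmetric group, $\chi^\lambda$ the irreducible character indexed by $\lambda$, $\chi^\lambda_\mu$ its value on $\mathcal{C}_\mu$, $\dim(\lambda)$ its degree. For $k\ge1$, $p_k(\lambda)=\sum_{i\ge1}\big[(\lambda_i-i+\tfrac12)^k-(-i+\tfrac12)^k\big]$. For a tuple (or partition) $K=(k_1,\ldots,k_s)$ of positive integers and $\beta\vdash d$, $$\widetilde W_{d,m}(K;(d),\beta)=\frac1{d!\,m!}\sum_{\lambda\vdash d}\mathfrak{c}_{\lambda,m}\frac{|\mathcal{C}_{(d)}|\chi^\lambda_{(d)}\,|\mathcal{C}_\beta|\chi^\lambda_\beta}{\dim(\lambda)}\prod_{i=1}^sp_{k_i}(\lambda),\qquad \mathfrak{c}_{\lambda,m}=\sum_{k=0}^m(-1)^k\binom mk\prod_{u\in\lambda}\frac{m-k+c(u)}{h(u)},$$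 where for a cell $u=(i,j)$ of the Young diagram of $\lambda$, $c(u)=j-i$ and $h(u)$ is its hook length.
   Formalization: The second binomial in the bracket, binom(d-j-1,k-j), carries an added factor (-1)^{j+1}; as printed the identity fails for even j (e.g. d=m=3, j=2, d'=i=1 gives left side 0, right side 1). *)

(* Defs.v *)
From HB Require Import structures.
From mathcomp Require Import all_boot all_order all_algebra all_fingroup.
From mathcomp Require Import all_solvable all_field all_character.

Set Implicit Arguments.
Unset Strict Implicit.
Unset Printing Implicit Defensive.

Import Order.TTheory GRing.Theory Num.Theory.
Local Open Scope ring_scope.

(* Partitions are weakly decreasing sequences of positive parts.  Those of [d]
   are enumerated by padding with zeros to length [d]; [mem_partitions] and
   [uniq_partitions] state that each occurs exactly once. *)

Definition is_partition (d : nat) (la : seq nat) : bool :=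
  [&& sorted geq la, 0%N \notin la & sumn la == d].

Definition partitions (d : nat) : seq (seq nat) :=
  [seq la <- [seq [seq x <- map val (tval t) | x != 0%N]
             | t <- enum {: d.-tuple 'I_d.+1} & sorted geq (map val (tval t))]
  | sumn la == d].

Lemma mem_partitions d la : (la \in partitions d) = is_partition d la.
Proof.
rewrite mem_filter /is_partition; case: (sumn la =P d) => [sla|]; last first.
  by rewrite !andbF.
rewrite andbT /=; apply/mapP/andP => [[t] | [sorted_la la0]].
  rewrite mem_filter => /andP[st _] ->; split; last by rewrite mem_filter.
  by apply: sorted_filter st => y x z /= le_yx le_zy; apply: leq_trans le_zy le_yx.
have le_d x : x \in la -> (x < d.+1)%N.
  rewrite -sla ltnS; elim: (la) => //= y s IHs; rewrite inE => /orP[/eqP-> |].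
    exact: leq_addr.
  by move=> /IHs/leq_trans-> //; apply: leq_addl.
have le_size : (size la <= d)%N.
  rewrite -sla; elim: (la) la0 => //= y s IHs.
  rewrite inE negb_or eq_sym -lt0n => /andP[y0 /IHs].
  by rewrite -add1n; apply: leq_add.
pose s : seq 'I_d.+1 := [seq inord x | x <- la ++ nseq (d - size la) 0%N].
have sz_s : size s == d by rewrite size_map size_cat size_nseq subnKC.
have Es : map val s = la ++ nseq (d - size la) 0%N.
  rewrite -map_comp -[RHS]map_id; apply/eq_in_map => x.
  rewrite mem_cat mem_nseq => x_s; rewrite /= inordK //.
  by case/orP: x_s => [/le_d // | /andP[_ /eqP->]].
exists (Tuple sz_s); last first.
  rewrite /= Es filter_cat (@eq_in_filter _ _ predT la) ?filter_predT; last first.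
    by move=> x x_la; apply: contraNneq la0 => <-.
  by elim: (d - size la)%N => [|n IHn] //=; rewrite cats0.
rewrite mem_filter mem_enum andbT /= Es.
have geq_trans : transitive geq by move=> y x z le1 le2; apply: leq_trans le2 le1.
rewrite (sorted_pairwise geq_trans) pairwise_cat -!(sorted_pairwise geq_trans).
rewrite sorted_la /=; apply/andP; split.
  by apply/allrelP => x y _; rewrite mem_nseq => /andP[_ /eqP->].
by elim: (d - size la)%N => [|[|n] IHn] //=.
Qed.

Lemma uniq_partitions d : uniq (partitions d).
Proof.
apply: filter_uniq; rewrite map_inj_in_uniq; first by rewrite filter_uniq // enum_uniq.
move=> t u; rewrite !mem_filter => /andP[st _] /andP[su _] Etu.
apply/val_inj/(inj_map val_inj)/(@sorted_eq _ geq) => //.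
- by move=> y x z le1 le2; apply: leq_trans le2 le1.
- by move=> x y /andP[/= le1 le2]; apply/eqP; rewrite eqn_leq le1 le2.
rewrite -(perm_filterC (fun x => x != 0%N)) perm_sym.
rewrite -(perm_filterC (fun x => x != 0%N)) perm_sym Etu perm_cat2l.
have zeros s : [seq x <- s | predC (fun x => x != 0%N) x]
             = nseq (size s - size [seq x <- s | x != 0%N]) 0%N.
  rewrite -(@count_predC _ (fun x => x != 0%N) s) size_filter addKn -size_filter.
  apply/all_pred1P/allP => x; rewrite mem_filter /= negbK.
  by case/andP.
by rewrite !zeros Etu !size_map !size_tuple.
Qed.

(* [1^(n-j), j] *)
Definition one_big_part (n j : nat) : seq nat := rcons (nseq (n - j) 1%N) j.

(* Cells are indexed from 0: the cell in row [r] and column [c] is [(r, c)]. *)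

Definition content (r c : nat) : algC := c%:R - r%:R.

Definition arm (la : seq nat) (r c : nat) : nat := nth 0%N la r - c.+1.
Definition leg (la : seq nat) (r c : nat) : nat :=
  count (fun x => c < x)%N (drop r.+1 la).
Definition hook (la : seq nat) (r c : nat) : nat := (arm la r c + leg la r c).+1.

(* The value at row [r] is that of the (r+1)-st part, so that - i + 1/2 becomes
   - (r+1) + 1/2. *)
Definition p_ (k : nat) (la : seq nat) : algC :=
  \sum_(r < size la)
    (((nth 0%N la r)%:R - r.+1%:R + 2%:R^-1) ^+ k - (- r.+1%:R + 2%:R^-1) ^+ k).

Definition frakc (la : seq nat) (m : nat) : algC :=
  \sum_(0 <= k < m.+1) (-1) ^+ k * 'C(m, k)%:R *
    \prod_(r < size la) \prod_(c < nth 0%N la r)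
      ((m%:R - k%:R + content r c) / (hook la r c)%:R).

(* A partition may be given here with its parts in any order. *)
Definition cycle_class (d : nat) (mu : seq nat) : {set 'S_d} :=
  [set s : 'S_d | perm_eq [seq #|pred_of_set B| | B <- enum (porbits s)] mu].

(* The standard tableau of shape [la] whose rows, read from top to bottom, list
   0, ..., d-1 has [x] in row [reshape_index la x] and in column
   [reshape_offset la x]. *)

Definition row_group (d : nat) (la : seq nat) : {set 'S_d} :=
  [set s : 'S_d | [forall x, reshape_index la (s x) == reshape_index la x]].

Definition column_group (d : nat) (la : seq nat) : {set 'S_d} :=
  [set s : 'S_d | [forall x, reshape_offset la (s x) == reshape_offset la x]].

(* The group algebra is the space of rows of the regular representation, whose
   basis vector of index [gring_index G g] is [g].  As [q * p] is here the
   permutation x |-> p (q x), usually written pq, this is the Young symmetrizer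
   \sum_p \sum_q sgn(q) pq, and the submodule it generates below is the usual
   left ideal C[S_d] c_la. *)
Definition young_symmetrizer (d : nat) (la : seq nat) :
    'rV[algC]_#|[set: 'S_d]%G| :=
  \sum_(p in row_group d la) \sum_(q in column_group d la)
    (-1) ^+ q *: delta_mx 0 (gring_index [set: 'S_d]%G (q * p)%g).

Definition specht_char (d : nat) (la : seq nat) : 'CF([set: 'S_d]%G) :=
  cfRepr (submod_repr
    (cyclic_mx_module (regular_repr algC [set: 'S_d]%G)
                      (young_symmetrizer d la))).

Definition chi (d : nat) (la mu : seq nat) : algC :=
  specht_char d la (repr (cycle_class d mu)).

Definition dim_irr (d : nat) (la : seq nat) : algC := specht_char d la 1%g.

Definition Wtilde (d m : nat) (K al be : seq nat) : algC :=
  (d`!%:R * m`!%:R)^-1 *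
  \sum_(la <- partitions d)
    frakc la m *
    ((#|cycle_class d al|%:R * chi d la al * #|cycle_class d be|%:R * chi d la be)
       / dim_irr d la) *
    \prod_(k <- K) p_ k la.

(* Generalized binomial coefficient x(x-1)...(x-k+1)/k!, zero for negative [k].
   It is needed at x = -1, where 'C(_, _) with truncated subtraction is wrong. *)
Definition gbinom (x : algC) (k : int) : algC :=
  if k is Posz n then (\prod_(i < n) (x - i%:R)) / n`!%:R else 0.

(* Main.v *)
Require Import Defs.
From HB Require Import structures.
From mathcomp Require Import all_boot all_order all_algebra all_fingroup.
From mathcomp Require Import all_solvable all_field all_character.
From mathcomp Require Import ring zify.

(** The class of the full cycle kills every partition except the hooks
    (d-k,1^k), so the sum over all partitions collapses to k = 0, ..., d-1, and
    for a hook every factor is explicit: the power sums of the shifted parts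
    telescope ([p_hook]); the hook-content product is a product of two binomial
    coefficients, of which an alternating sum leaves 'C(d-k-1, d-m) times the
    degree 'C(d-1, k) ([frakc_hook]), and that degree cancels the denominator;
    the character is the coefficient of q^k in (1+q)^(d-j-1) (1-(-q)^j)
    ([hook_char_value]).

    The characters are those of the ideals generated by Young symmetrizers, and
    the work is to evaluate them on hooks.  The tool is psi_K, the character
    induced from the stabilizer of a set K of k points, where a permutation acts
    by its sign on K; this is the character of the k-th exterior power of the
    permutation module.  Its value at an element with a single nontrivial cycle
    J counts the k-sets that contain J or avoid it ([set_sign_ind_cycle]).
    With theta_k the character of the hook (d-k,1^k), the identity
    psi_(k+1) = theta_(k+1) + theta_k ([hook_char_branch]) is the decomposition
    of the exterior powers of the sum of the trivial and the standard module;
    together with psi_0 = theta_0 it determines theta_k by induction on k.  It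
    follows from four facts.
    - theta_k is irreducible, because a vector of the module fixed by the row
      group is a multiple of the symmetrizer ([hook_row_fixed]).
    - theta_k occurs in psi_k and in psi_(k+1): the module contains explicit
      vectors that transform under the sign of a k-set and of a (k+1)-set
      ([cfdot_hook_notarm], [cfdot_hook_leg]).
    - theta_k has degree at least 'C(d-1, k), since that many translates of the
      symmetrizer are independent ([hook_specht_degree]).
    - psi_k has degree 'C(d, k), so that Pascal's rule leaves no room for a third
      constituent.

    Occurrence in psi_k and psi_(k+1) also pins the shape: a transposition
    argument shows that psi_K meets the module of a partition la only if la has at
    least d - #|K| columns and at least #|K| rows, and for both values of #|K|
    this forces la = (d-k,1^k) ([hook_constituent]).  Hence nonhooks have no
    constituent theta_k.  At a full cycle s the hooks contribute d to the sum of
    |chi(s)|^2 over the irreducible characters, while that sum is the order of the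
    centralizer of s, which is at most d.  So every other irreducible character,
    and with it the character of every nonhook, vanishes at s
    ([full_cycle_cent]).  The same count gives the size of the class of full
    cycles ([card_full_cycles]). *)

Set Implicit Arguments.
Unset Strict Implicit.
Unset Printing Implicit Defensive.

Import Order.TTheory GRing.Theory Num.Theory.
Local Open Scope ring_scope.

(** * Constituents of characters *)

Lemma mxtrace_idempotent (F : fieldType) n (P : 'M[F]_n) :
  P *m P = P -> \tr P = (\rank P)%:R.
Proof.
move=> idP; have:= mulmx_base P.
have/row_freeP[A]:= row_base_free P; have/row_fullP[B]:= col_base_full P.
move: A B (row_base P) (col_base P); move: (\rank P) => r A B R C BC RA EP.
suffices RC: R *m C = 1%:M by rewrite -EP mxtrace_mulC RC mxtrace1.
have: B *m (P *m P) *m A = B *m P *m A by rewrite idP.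
by rewrite -EP !mulmxA BC mul1mx -!mulmxA RA !mulmx1.
Qed.

Section LinearConstituent.

Variables (gT : finGroupType) (G H : {group gT}) (n : nat).
Variables (rG : mx_representation algC G n) (phi : 'CF(H)).
Hypotheses (sHG : H \subset G) (lin_phi : phi \is a linear_char).

Lemma cfdot_Res_lin :
  '['Res[H] (cfRepr rG), phi] =
    #|H|%:R^-1 * \tr (\sum_(h in H) (phi h)^* *: rG h).
Proof.
rewrite cfdotE linear_sum; congr (_ * _); apply: eq_bigr => h Hh.
by rewrite cfResE // cfunE (subsetP sHG) // linearZ mulrC.
Qed.

Lemma cfdot_Res_lin_eq0 :
  \sum_(h in H) (phi h)^* *: rG h = 0 -> '['Res[H] (cfRepr rG), phi] = 0.
Proof. by move=> E0; rewrite cfdot_Res_lin E0 linear0 mulr0. Qed.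

(** The multiplicity of [phi] is the trace of the projection onto the vectors
    that transform by [phi], hence the rank of that projection, which is nonzero
    as soon as such a vector exists. *)
Lemma cfdot_Res_lin_neq0 (v : 'rV_n) :
    v != 0 -> (forall h, h \in H -> v *m rG h = phi h *: v) ->
  '['Res[H] (cfRepr rG), phi] != 0.
Proof.
move=> nz_v v_phi; have nzH : #|H|%:R != 0 :> algC by rewrite pnatr_eq0 -lt0n.
pose P : 'M_n := #|H|%:R^-1 *: \sum_(h in H) (phi h)^* *: rG h.
have phiVK h : h \in H -> (phi h)^* * phi h = 1.
  by move=> Hh; rewrite mulrC -normCK normC_lin_char // expr1n.
have rGP h : h \in H -> rG h *m P = phi h *: P.
  move=> Hh; rewrite /P -scalemxAr scalerA mulrC -scalerA; congr (_ *: _).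
  rewrite mulmx_sumr scaler_sumr [RHS](reindex_inj (mulgI h)) /=.
  apply: eq_big => [g | g Hg]; first by rewrite groupMl.
  rewrite -scalemxAr -repr_mxM ?(subsetP sHG) // scalerA; congr (_ *: _).
  by rewrite lin_charM // rmorphM mulrA [phi h * _]mulrC phiVK ?mul1r.
have idP : P *m P = P.
  rewrite {1}/P -scalemxAl mulmx_suml; under eq_bigr => h Hh.
    by rewrite -scalemxAl rGP // scalerA phiVK // scale1r; over.
  by rewrite sumr_const -scaler_nat scalerA mulVf // scale1r.
have vP : v *m P = v.
  rewrite /P -scalemxAr mulmx_sumr; under eq_bigr => h Hh.
    by rewrite -scalemxAr v_phi // scalerA phiVK // scale1r; over.
  by rewrite sumr_const -scaler_nat scalerA mulVf // scale1r.
have ->: '['Res[H] (cfRepr rG), phi] = \tr P by rewrite cfdot_Res_lin linearZ.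
rewrite mxtrace_idempotent // pnatr_eq0 mxrank_eq0; apply: contraNneq nz_v => P0.
by rewrite -vP P0 mulmx0.
Qed.

End LinearConstituent.

Lemma cfunDE (gT : finGroupType) (G : {group gT}) (phi psi : 'CF(G)) x :
  (phi + psi) x = phi x + psi x.
Proof. by rewrite cfunE. Qed.

Lemma char_le0_eq0 (gT : finGroupType) (G : {group gT}) (phi : 'CF(G)) :
  phi \is a character -> phi 1%g <= 0 -> phi = 0.
Proof.
by move=> Nphi le0; apply/eqP; rewrite -char1_eq0 // eq_le le0 char1_ge0.
Qed.

Lemma constituent_split (gT : finGroupType) (G : {group gT}) (phi chi : 'CF(G)) :
    phi \is a character -> chi \in irr G -> '[chi, phi] != 0 ->
  exists2 psi, psi \is a character & phi = chi + psi.
Proof.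
move=> Nphi /irrP[i ->]; rewrite cfdotC fmorph_eq0 => phi_i.
by apply/constt_charP.
Qed.

(** * Permutations and sets *)

Section PermutationsAndSets.

Variable T : finType.
Implicit Types (A B K S : {set T}) (s : {perm T}).

(** Induction on [A]: a permutation that is right on all of [A] but [x] is
    corrected by the transposition of the value it gives at [x] with the value
    wanted there; injectivity keeps the other points of [A] out of it. *)
Lemma perm_extend A (f : T -> T) :
  {in A &, injective f} -> exists s : {perm T}, {in A, s =1 f}.
Proof.
have [n] := ubnP #|A|; elim: n A => // n IHn A leAn injf.
have [->|[x Ax]] := set_0Vmem A; first by exists 1%g => y; rewrite inE.
have [||s sE] := IHn (A :\ x).
- by move: leAn; rewrite (cardsD1 x A) Ax.
- by move=> y z /setD1P[_ Ay] /setD1P[_ Az]; apply: injf.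
exists (s * tperm (s x) (f x))%g => y Ay; rewrite permM.
have [->|ne_yx] := eqVneq y x; first by rewrite tpermL.
have Ey: s y = f y by apply: sE; rewrite !inE ne_yx.
rewrite tpermD ?Ey //; first by rewrite -Ey (inj_eq perm_inj) eq_sym.
by rewrite eq_sym; apply: contra_neq ne_yx; apply: injf.
Qed.

Lemma perm_map_set B K : #|B| = #|K| ->
  exists y : {perm T}, forall z, (y z \in K) = (z \in B).
Proof.
move=> eqBK; case: (pickP (mem B)) => [z0 _|B0]; last first.
  have K0: K = set0.
    by apply/eqP; rewrite -cards_eq0 -eqBK; apply/eqP/eq_card0.
  by exists 1%g => z; rewrite K0 inE; apply/esym/B0.
pose f z := nth z (enum K) (index z (enum B)).
have szf z : z \in B -> (index z (enum B) < size (enum K))%N.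
  by move=> Bz; rewrite -cardE -eqBK cardE index_mem mem_enum.
have [|y yE] := @perm_extend B f.
  move=> u v Bu Bv; rewrite /f (set_nth_default v) ?szf // => /eqP.
  rewrite nth_uniq ?szf ?enum_uniq // => /eqP Eidx.
  by rewrite -(nth_index u (_ : u \in enum B)) ?Eidx ?nth_index ?mem_enum.
exists y => z; suffices ->: B = y @^-1: K by rewrite inE.
apply/eqP; rewrite eqEcard card_preimset ?eqBK ?leqnn ?andbT; last exact: perm_inj.
by apply/subsetP => u Bu; rewrite inE yE // -mem_enum mem_nth ?szf.
Qed.

Lemma perm_onS S K s : S \subset K -> perm_on S s -> perm_on K s.
Proof. by move=> sSK /subset_trans; apply. Qed.

Lemma pigeonhole (f : T -> nat) N K : (forall x, f x < N)%N -> (N < #|K|)%N ->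
  exists x y, [/\ x \in K, y \in K, x != y & f x = f y].
Proof.
move=> ltfN ltNK; case: (boolP (dinjectiveb f K)) => [/dinjectiveP injf|].
  have: (#|[set Ordinal (ltfN x) | x in K]| <= N)%N.
    by rewrite -[X in (_ <= X)%N]card_ord max_card.
  rewrite card_in_imset; first by rewrite leqNgt ltNK.
  by move=> x y Kx Ky /(congr1 val) /=; apply: injf.
by case/dinjectivePn => x Kx [y] /[!inE] /andP[ne Ky] E; exists x, y; rewrite eq_sym.
Qed.

(** Complementation turns supersets of [S] into subsets of [~: S]. *)
Lemma card_supersets S k : (k <= #|T|)%N ->
  #|[set B : {set T} | (S \subset B) && (#|B| == k)]| = 'C(#|~: S|, #|T| - k).
Proof.
move=> lekT; rewrite -cards_draws -(card_imset _ (inv_inj (@setCK T))).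
apply: eq_card => B; rewrite inE; apply/imsetP/andP => [[A]|[sBJ /eqP cB]].
  rewrite inE => /andP[sJA /eqP cA] ->.
  by rewrite setCS sJA -cA -(cardsC A) addKn.
exists (~: B); rewrite ?setCK // inE -setCS setCK sBJ.
by rewrite -(eqn_add2l #|B|) cardsC cB subnK /=.
Qed.

End PermutationsAndSets.

Lemma card_ord_lt n k : (k <= n)%N -> #|[set x : 'I_n | (x < k)%N]| = k.
Proof.
move=> lekn; have inj_w : injective (widen_ord lekn).
  by move=> x y /(congr1 val) /= /val_inj.
rewrite -[RHS]card_ord -(card_imset _ inj_w).
apply: eq_card => x; rewrite inE; apply/idP/imsetP => [ltxk | [y _ ->] /=]; last exact: ltn_ord.
by exists (Ordinal ltxk) => //; apply: val_inj.
Qed.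

(** * The sign of a set stabilizer and the character it induces *)

Section SignCharacter.

Variable T : finType.
Implicit Types (K : {set T}) (s : {perm T}).

Definition set_sign K s : algC := (-1) ^+ restr_perm K s.

Definition set_stab K : {group {perm T}} := 'N(K | 'P)%G.

Lemma set_stabP K s : reflect (forall x, (s x \in K) = (x \in K)) (s \in set_stab K).
Proof.
by apply: (iffP idP) => [Ks x|nK]; [exact: (astabs_act x Ks)|apply/astabsP].
Qed.

Lemma set_sign_mx_repr K :
  mx_repr (set_stab K) (fun s => (set_sign K s)%:M : 'M[algC]_1).
Proof.
split=> [|s t Ks Kt]; first by rewrite /set_sign morph1 odd_perm1.
by rewrite /set_sign morphM // odd_permM signr_addb scalar_mxM.
Qed.

Definition set_sign_cfun K : 'CF(set_stab K) :=
  cfRepr (MxRepresentation (set_sign_mx_repr K)).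

Lemma set_sign_cfunE K s :
  set_sign_cfun K s = set_sign K s *+ (s \in set_stab K).
Proof. by rewrite cfunE mxtrace_scalar. Qed.

Lemma set_sign_lin_char K : set_sign_cfun K \is a linear_char.
Proof. by rewrite qualifE /= cfRepr_char cfRepr1 eqxx. Qed.

Lemma set_sign_on K s : perm_on K s -> set_sign K s = (-1) ^+ s.
Proof.
move=> Ks; have sK: s \in set_stab K.
  by apply/set_stabP => x; rewrite perm_closed.
congr (_ ^+ odd_perm _); apply/permP => x; have [Kx|K'x] := boolP (x \in K).
  by rewrite restr_permE.
by rewrite (out_perm Ks) // (out_perm (restr_perm_on _ _)).
Qed.

Lemma set_sign_off K s : perm_on (~: K) s -> set_sign K s = 1.
Proof.
move=> K's; have sK: s \in set_stab K.
  apply/set_stabP => x; apply: negb_inj.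
  by have:= perm_closed x K's; rewrite !inE.
rewrite /set_sign; suffices -> : restr_perm K s = 1%g by rewrite odd_perm1.
apply/permP => x; rewrite perm1; have [Kx|K'x] := boolP (x \in K).
  by rewrite restr_permE // (out_perm K's) // inE Kx.
by rewrite (out_perm (restr_perm_on _ _)).
Qed.

Lemma set_stab_split K s : s \in set_stab K ->
  exists s1 s2 : {perm T}, [/\ perm_on K s1, perm_on (~: K) s2,
    s = (s1 * s2)%g & set_sign K s = (-1) ^+ s1].
Proof.
move=> Ks; pose s1 := restr_perm K s; exists s1, (s1^-1 * s)%g.
split=> //; [exact: restr_perm_on | | by rewrite mulKVg].
apply/subsetP => x; rewrite !inE permM; apply: contraNN => Kx.
have Ky: (s1^-1)%g x \in K by rewrite perm_closed ?perm_onV ?restr_perm_on.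
by rewrite -[s _](restr_permE Ks Ky) -/s1 permKV.
Qed.

(** This is the character of the exterior power of degree [#|K|] of the natural
    permutation module.  The induced form gives both its values and, by Frobenius
    reciprocity, its constituents. *)
Definition set_sign_ind K : 'CF([set: {perm T}]%G) :=
  'Ind[[set: {perm T}]%G] (set_sign_cfun K).

Lemma set_sign_ind_char K : set_sign_ind K \is a character.
Proof. by rewrite cfInd_char // lin_charW // set_sign_lin_char. Qed.

End SignCharacter.

Section SetSignInd.

Variable T : finType.
Implicit Types (K B : {set T}) (g y : {perm T}).

(** The conjugate [g ^ y] preserves [K] exactly when [g] preserves the preimage
    [B].  Since [g] is transitive on its cycle and fixes everything else, this
    means that the cycle lies inside [B], and then the sign on [K] is the sign of
    [g], or outside [B], and then [g ^ y] is the identity on [K]. *)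
Lemma set_sign_cfunJ K g x y (B := y @^-1: K) : perm_on (porbit g x) g ->
  set_sign_cfun K (g ^ y)%g =
    (porbit g x \subset ~: B)%:R + (-1) ^+ g *+ (porbit g x \subset B).
Proof.
set J := porbit g x => Jg; have Jx : x \in J by apply: porbit_id.
have gyE z : (g ^ y)%g (y z) = y (g z) by rewrite permJ.
have [sJB|nsJB] := boolP (J \subset B).
  have /negPf->: ~~ (J \subset ~: B).
    by apply/subsetPn; exists x; rewrite // inE (subsetP sJB).
  rewrite add0r set_sign_cfunE; have Kgy: perm_on K (g ^ y)%g.
    apply/subsetP => z; rewrite !inE -[z](permKV y) gyE (inj_eq perm_inj).
    by move=> /(subsetP Jg)/(subsetP sJB); rewrite inE.
  rewrite set_sign_on // odd_permJ; suffices ->: (g ^ y)%g \in set_stab K by [].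
  by apply/set_stabP => z; rewrite perm_closed.
rewrite addr0; have [sJB'|nsJB'] := boolP (J \subset ~: B).
  rewrite set_sign_cfunE; have Kgy: perm_on (~: K) (g ^ y)%g.
    apply/subsetP => z; rewrite !inE -[z](permKV y) gyE (inj_eq perm_inj).
    by move=> /(subsetP Jg)/(subsetP sJB'); rewrite !inE.
  rewrite set_sign_off //; suffices ->: (g ^ y)%g \in set_stab K by [].
  by apply/set_stabP => z; apply: negb_inj; have:= perm_closed z Kgy; rewrite !inE.
rewrite set_sign_cfunE; suffices /negPf->: (g ^ y)%g \notin set_stab K by [].
apply/set_stabP => Kgy; have BE z : (g z \in B) = (z \in B).
  by rewrite !inE -gyE Kgy.
have BX z : z \in J -> (z \in B) = (x \in B).
  by case/porbitP => i ->; elim: i => [|i IHi]; rewrite ?expg0 ?perm1 // expgSr permM BE.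
have [Bx|B'x] := boolP (x \in B).
  by case/subsetP: nsJB => z /BX->.
by case/subsetP: nsJB' => z /BX; rewrite in_setC => ->.
Qed.

(** The permutations that pull [K] back to [B] form a coset of its stabilizer. *)
Lemma card_preimset_perm_eq K B :
  #|[set y : {perm T} | y @^-1: K == B]| = ((#|B| == #|K|) * #|set_stab K|)%N.
Proof.
case: eqP => [eqBK|neBK]; last first.
  apply: eq_card0 => y; rewrite !inE; apply: contra_notF neBK => /eqP <-.
  by rewrite card_preimset //; apply: perm_inj.
rewrite mul1n; have [y0 y0K] := perm_map_set eqBK.
rewrite -(card_lcoset (set_stab K) y0); apply: eq_card => y.
rewrite mem_lcoset [LHS]inE.
apply/eqP/set_stabP => [EB z|yK].
  by rewrite permM -[in RHS](permKV y0 z) y0K -EB inE.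
by apply/setP=> z; rewrite inE -y0K -(yK (y0 z)) permM permK.
Qed.

(** In the sum over conjugators, group those with the same preimage of [K]: the
    order of the stabilizer cancels, and there remains a count of the sets of
    size [#|K|] that avoid the cycle or, with the sign of [g], contain it. *)
Lemma set_sign_ind_cycle K g x : perm_on (porbit g x) g ->
  set_sign_ind K g = 'C(#|~: porbit g x|, #|K|)%:R
    + (-1) ^+ g * 'C(#|~: porbit g x|, #|~: K|)%:R.
Proof.
set J := porbit g x => Jg; rewrite cfIndE ?subsetT //.
under eq_bigr => y _ do rewrite (set_sign_cfunJ K y Jg) -/J.
pose F B : algC := (J \subset ~: B)%:R + (-1) ^+ g *+ (J \subset B).
rewrite (partition_big (fun y : {perm T} => y @^-1: K) predT) //=.
rewrite (eq_bigr (fun B => #|set_stab K|%:R * (F B *+ (#|B| == #|K|)))) => [|B _].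
  rewrite -mulr_sumr mulKf ?pnatr_eq0 -?lt0n ?cardG_gt0 //.
  rewrite (eq_bigr (fun B => (((J \subset ~: B) && (#|B| == #|K|))%:R : algC)
      + (-1) ^+ g * ((J \subset B) && (#|B| == #|K|))%:R)) => [|B _]; last first.
    rewrite /F; case: (_ \subset _); case: (_ \subset _); case: (_ == _);
      by rewrite /= ?(mulr1n, mulr0n, mulr1, mulr0, addr0).
  rewrite big_split -mulr_sumr -!natr_sum -!big_mkcond /= !sum1_card.
  congr (_%:R + _ * _%:R).
    rewrite -cards_draws; apply: eq_card => B; rewrite !inE.
    by rewrite [LHS]unfold_in /= -[J \subset _]setCS setCK.
  have ->: #|~: K| = (#|T| - #|K|)%N by rewrite -(cardsC K) addKn.
  rewrite -(card_supersets _ (max_card (mem K))).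
  by apply: eq_card => B; rewrite [RHS]inE.
rewrite (eq_bigr (fun=> F B)); last by move=> y /andP[_ /eqP->].
rewrite -big_filter big_const_seq count_predT iter_addr_0 -cardE.
rewrite -[#|_|](_ : #|[set y : {perm T} | y @^-1: K == B]| = _); last first.
  by apply: eq_card => y; rewrite !inE [RHS]unfold_in /= inE.
by rewrite card_preimset_perm_eq mulrnA mulr_natl.
Qed.

End SetSignInd.

Lemma mem_set_stabJ (T : finType) (K : {set T}) (g y : {perm T}) :
  ((g ^ y)%g \in set_stab (y @: K)) = (g \in set_stab K).
Proof.
have gyE z : (g ^ y)%g (y z) = y (g z) by rewrite permJ.
have memy z : (y z \in y @: K) = (z \in K) by rewrite mem_imset //; apply: perm_inj.
apply/set_stabP/set_stabP => gK z; first by rewrite -memy -gyE gK memy.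
by rewrite -[z](permKV y) gyE !memy.
Qed.

Lemma set_sign_cfunJ_imset (T : finType) (K : {set T}) (g y : {perm T}) :
  set_sign_cfun (y @: K) (g ^ y)%g = set_sign_cfun K g.
Proof.
have gyE z : (g ^ y)%g (y z) = y (g z) by rewrite permJ.
have memy z : (y z \in y @: K) = (z \in K) by rewrite mem_imset //; apply: perm_inj.
rewrite !set_sign_cfunE mem_set_stabJ; case: (boolP (g \in _)) => // Kg; rewrite /set_sign.
have Kgy : (g ^ y)%g \in set_stab (y @: K) by rewrite mem_set_stabJ.
suffices ->: restr_perm (y @: K) (g ^ y) = (restr_perm K g ^ y)%g by rewrite odd_permJ.
apply/permP => z; rewrite -[z](permKV y) permJ; set x := (y^-1)%g z.
have [Kx|K'x] := boolP (x \in K); first by rewrite !restr_permE ?memy // gyE.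
by rewrite !(out_perm (restr_perm_on _ _)) ?memy.
Qed.

(** A permutation that carries [K] to [K'] conjugates one stabilizer to the
    other, signs included. *)
Lemma eq_set_sign_ind (T : finType) (K K' : {set T}) :
  #|K| = #|K'| -> set_sign_ind K = set_sign_ind K'.
Proof.
move=> /perm_map_set[y yE]; have -> : K' = y @: K.
  by apply/setP => z; rewrite -[z](permKV y) yE mem_imset //; apply: perm_inj.
apply/cfun_inP => g _; rewrite !cfIndE ?subsetT //; congr (_%:R^-1 * _).
  have -> : set_stab (y @: K) = (set_stab K :^ y)%g :> {set _}.
    by apply/setP => h; rewrite mem_conjg -[in LHS](conjgKV y h) mem_set_stabJ.
  by rewrite cardJg.
rewrite [RHS](reindex_inj (mulIg y)) /=; apply: eq_big => [x | x _].
  by rewrite !inE.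
by rewrite conjgM set_sign_cfunJ_imset.
Qed.

(** The identity is a cycle of length 1, and the two counts add up by Pascal's
    rule. *)
Lemma set_sign_ind_degree (T : finType) (K : {set T}) :
  (0 < #|T|)%N -> set_sign_ind K 1%g = 'C(#|T|, #|K|)%:R.
Proof.
case/card_gt0P => x _.
have P1 : porbit (1 : {perm T}) x = [set x].
  apply/setP => y; rewrite inE.
  by apply/porbitP/eqP => [[i ->]|->]; [|exists 0%N]; rewrite expg1n perm1.
rewrite (@set_sign_ind_cycle _ K 1%g x); last first.
  by apply/subsetP => y; rewrite inE perm1 eqxx.
rewrite P1 cardsC1 odd_perm1 mul1r -natrD.
have -> : #|~: K| = (#|T| - #|K|)%N by rewrite -(cardsC K) addKn.
have := max_card (mem K); have : (0 < #|T|)%N by apply/card_gt0P; exists x.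
case: #|T| => // n _ /=; case: #|K| => [|k] lekn; first by rewrite !bin0 bin_small.
by rewrite subSS bin_sub // binS addnC.
Qed.

(** * Young symmetrizers in the regular representation *)

Lemma eq_opp_mx0 m n (M : 'M[algC]_(m, n)) : M = - M -> M = 0.
Proof.
move=> EM; apply/matrixP => i j; rewrite [RHS]mxE; apply/eqP.
by rewrite -eqNr; have:= congr1 (fun N : 'M_(m, n) => N i j) EM; rewrite mxE => <-.
Qed.

Section YoungModules.

Variable T : finType.
Let G : {group {perm T}} := [set: {perm T}]%G.
Implicit Types (s w : {perm T}) (f : T -> nat) (K : {set T}).

(** With [f] the row or the column index of the boxes of a tableau, this is the
    row group or the column group. *)
Definition fiber_stab f : {set {perm T}} :=
  [set s : {perm T} | [forall x, f (s x) == f x]].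

Lemma fiber_stabP f s : reflect (forall x, f (s x) = f x) (s \in fiber_stab f).
Proof. by rewrite inE; apply: (iffP forallP) => fs x; apply/eqP/fs. Qed.

Lemma fiber_stab_group_set f : group_set (fiber_stab f).
Proof.
apply/group_setP; split=> [|s t /fiber_stabP fs /fiber_stabP ft].
  by apply/fiber_stabP => x; rewrite perm1.
by apply/fiber_stabP => x; rewrite permM ft fs.
Qed.
Canonical fiber_stab_group f := Group (fiber_stab_group_set f).

Lemma tperm_fiber_stab f x y : f x = f y -> tperm x y \in fiber_stab f.
Proof. by move=> fxy; apply/fiber_stabP => z; case: tpermP => // ->. Qed.

Section Symmetrizers.

Variables (n : nat) (rG : mx_representation algC G n).

Definition row_sum f : 'M_n := \sum_(p in fiber_stab f) rG p.

Definition signed_sum f : 'M_n := \sum_(q in fiber_stab f) (-1) ^+ q *: rG q.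

Lemma row_sum_mull f p : p \in fiber_stab f -> rG p *m row_sum f = row_sum f.
Proof.
move=> Rp; rewrite mulmx_sumr [RHS](reindex_inj (mulgI p)) /=.
by apply: eq_big => [q | q Rq]; rewrite ?groupMl // repr_mxM ?inE.
Qed.

Lemma row_sum_mulr f p : p \in fiber_stab f -> row_sum f *m rG p = row_sum f.
Proof.
move=> Rp; rewrite mulmx_suml [RHS](reindex_inj (mulIg p)) /=.
by apply: eq_big => [q | q Rq]; rewrite ?groupMr // repr_mxM ?inE.
Qed.

Lemma signed_sum_mulr f q :
  q \in fiber_stab f -> signed_sum f *m rG q = (-1) ^+ q *: signed_sum f.
Proof.
move=> Cq; rewrite mulmx_suml scaler_sumr [RHS](reindex_inj (mulIg q)) /=.
apply: eq_big => [p | p Cp]; rewrite ?groupMr // repr_mxM ?inE // -scalemxAl.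
by rewrite scalerA odd_permM signr_addb mulrCA -expr2 sqrr_sign mulr1.
Qed.

Definition set_sign_sum K : 'M_n := \sum_(h in set_stab K) (set_sign K h)^* *: rG h.

Lemma set_sign_sum_mull K g : g \in set_stab K ->
  rG g *m set_sign_sum K = set_sign K g *: set_sign_sum K.
Proof.
move=> Kg; rewrite mulmx_sumr scaler_sumr [RHS](reindex_inj (mulgI g)) /=.
apply: eq_big => [h | h Kh]; first by rewrite groupMl.
rewrite -scalemxAr -repr_mxM ?inE // scalerA; congr (_ *: _).
rewrite /set_sign morphM // odd_permM signr_addb rmorphM !rmorph_sign.
by rewrite mulrA -expr2 sqrr_sign mul1r.
Qed.

(** The transposition of [x] and [y] is absorbed by [row_sum f]; moved past [w] it
    becomes a transposition inside [K], which [set_sign_sum K] turns into -1. *)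
Lemma row_sum_set_sign_sum0 f K w x y : x != y -> f x = f y ->
  w x \in K -> w y \in K -> row_sum f *m rG w *m set_sign_sum K = 0.
Proof.
move=> ne_xy fxy Kx Ky; apply: eq_opp_mx0.
set M := _ *m _.
rewrite {1}/M -(row_sum_mulr (tperm_fiber_stab fxy)) -mulmxA -mulmxA.
rewrite [rG _ *m (_ *m _)]mulmxA -repr_mxM ?inE //.
rewrite [(tperm x y * w)%g]conjgC repr_mxM ?inE //.
rewrite tpermJ -[rG w *m _ *m _]mulmxA set_sign_sum_mull; last first.
  by apply/set_stabP => z; case: tpermP => [->|->|//]; rewrite ?Kx ?Ky.
rewrite set_sign_on; last first.
  apply/subsetP => z; rewrite inE; apply: contraR => K'z.
  by rewrite tpermD //; apply: contraNneq K'z => <-.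
by rewrite odd_tperm (inj_eq perm_inj) ne_xy expr1 scaleN1r !mulmxN mulmxA.
Qed.

(** Here the transposition costs a sign on the left and, being outside [K] after
    the move past [w], none on the right. *)
Lemma signed_sum_set_sign_sum0 f K w x y : x != y -> f x = f y ->
  w x \notin K -> w y \notin K -> signed_sum f *m rG w *m set_sign_sum K = 0.
Proof.
move=> ne_xy fxy Kx Ky; apply: eq_opp_mx0.
set M := _ *m _.
have := signed_sum_mulr (tperm_fiber_stab fxy).
rewrite odd_tperm ne_xy expr1 scaleN1r => /(congr1 -%R); rewrite opprK => EB.
rewrite {1}/M -EB !mulNmx -!mulmxA.
rewrite [rG (tperm _ _) *m (_ *m _)]mulmxA -repr_mxM ?inE //.
rewrite [(tperm x y * w)%g]conjgC repr_mxM ?inE //.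
rewrite tpermJ -[rG w *m _ *m _]mulmxA set_sign_sum_mull; last first.
  apply/set_stabP => z; case: tpermP => [->|->|//]; last by rewrite (negPf Kx) (negPf Ky).
  by rewrite (negPf Kx) (negPf Ky).
rewrite set_sign_off; last first.
  apply/subsetP => z; rewrite !inE; apply: contraNN => Kz.
  by rewrite tpermD //; [apply: contraNneq Kx => -> | apply: contraNneq Ky => ->].
by rewrite scale1r mulmxA.
Qed.

End Symmetrizers.

Section SpechtModule.

Variables row_of col_of : T -> nat.
Local Notation aG := (regular_repr algC G).
Local Notation R := (fiber_stab row_of).
Local Notation C := (fiber_stab col_of).
Local Notation gvec g := (delta_mx 0 (gring_index G g%g) : 'rV[algC]_#|G|).

(** Only the row and column indices of the boxes enter, so that hooks can be
    treated through the two sets of boxes that their groups permute. *)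
Definition young_sym : 'rV[algC]_#|G| :=
  \sum_(p in R) \sum_(q in C) (-1) ^+ q *: gvec (q * p).

Definition specht_mod := cyclic_mx aG young_sym.

Definition specht_cfun : 'CF(G) :=
  cfRepr (submod_repr (cyclic_mx_module aG young_sym)).

Lemma mul_delta_regular g h : gvec g *m aG h = gvec (g * h).
Proof. by rewrite -rowE rowK gring_indexK ?inE. Qed.

Lemma regular_coef (v : 'rV_#|G|) g h :
  (v *m aG g) 0 (gring_index G h) = v 0 (gring_index G (h * g^-1)%g).
Proof.
rewrite mxE (bigD1 (gring_index G (h * g^-1)%g)) //= big1 => [|i ne].
  by rewrite !mxE gring_indexK ?inE // mulgKV !eqxx mulr1 addr0.
rewrite !mxE /= (inj_in_eq (can_in_inj (gring_indexK (G := G)))) ?inE //.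
rewrite -(inj_eq (mulIg (g^-1)%g)) mulgK; case: eqP => [E|]; last by rewrite mulr0.
by case/eqP: ne; rewrite E gring_valK.
Qed.

Lemma young_symE : young_sym = gvec 1 *m signed_sum aG col_of *m row_sum aG row_of.
Proof.
rewrite /young_sym mulmx_sumr; apply: eq_bigr => p _.
rewrite -mulmxA mulmx_suml mulmx_sumr; apply: eq_bigr => q _.
by rewrite -scalemxAl -scalemxAr -repr_mxM ?inE // mul_delta_regular mul1g.
Qed.

Lemma young_sym_coef h :
  young_sym 0 (gring_index G h) =
    \sum_(p in R) \sum_(q in C) (-1) ^+ q *+ (h == q * p)%g.
Proof.
rewrite summxE; apply: eq_bigr => p _; rewrite summxE; apply: eq_bigr => q _.
rewrite !mxE /= (inj_in_eq (can_in_inj (gring_indexK (G := G)))) ?inE //.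
by rewrite mulr_natr.
Qed.

Lemma specht_modP (v : 'rV_#|G|) : (v <= specht_mod)%MS ->
  exists a : {perm T} -> algC, v = \sum_w a w *: (young_sym *m aG w).
Proof.
case/cyclic_mxP => A /envelop_mxP[a ->] ->; exists a.
rewrite mulmx_sumr; apply: eq_big => [w | w _]; first by rewrite inE.
by rewrite scalemxAr.
Qed.

Lemma specht_mod_mulr (v : 'rV_#|G|) g :
  (v <= specht_mod)%MS -> (v *m aG g <= specht_mod)%MS.
Proof.
move=> Vv; apply: submx_trans (submxMr _ Vv) _.
by apply: (mxmoduleP (cyclic_mx_module aG young_sym)); rewrite inE.
Qed.

Lemma cfdot_specht_eq0 K :
    (forall w, young_sym *m aG w *m set_sign_sum aG K = 0) ->
  '[specht_cfun, set_sign_ind K] = 0.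
Proof.
move=> E0; rewrite -cfdot_Res_l; apply: cfdot_Res_lin_eq0; first exact: subsetT.
pose I := val_submod (1%:M : 'M_(\rank specht_mod)).
transitivity (in_submod specht_mod (I *m set_sign_sum aG K)).
  rewrite mulmx_sumr linear_sum; apply: eq_bigr => h Kh.
  by rewrite -scalemxAr linearZ /= set_sign_cfunE Kh.
rewrite [X in in_submod _ X](_ : _ = 0) ?linear0 //.
apply/row_matrixP => i; rewrite row0 row_mul.
have /specht_modP[a ->]: (row i I <= specht_mod)%MS.
  by apply: submx_trans (row_sub _ _) (val_submodP _).
rewrite mulmx_suml big1 // => w _.
by rewrite -scalemxAl E0 scaler0.
Qed.

(** With fewer columns than points outside [K], two boxes of a common column are
    always sent outside [K], whatever the permutation [w], and the column sum
    annihilates the projection onto the sign of [K]. *)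
Lemma cfdot_specht_col K N : (forall x, col_of x < N)%N -> (N < #|~: K|)%N ->
  '[specht_cfun, set_sign_ind K] = 0.
Proof.
move=> ltcN ltNK; apply: cfdot_specht_eq0 => w.
set E := set_sign_sum _ _; set B := signed_sum aG col_of.
have BE p : B *m (aG (p * w)%g *m E) = 0.
  have [||x [y [Kx Ky ne_xy cxy]]] :=
    @pigeonhole T (fun x => col_of ((p * w)^-1 x)%g) N (~: K); [by []|by []|].
  rewrite mulmxA; apply: signed_sum_set_sign_sum0 cxy _ _.
  - by rewrite (inj_eq perm_inj).
  - by rewrite permKV -in_setC.
  - by rewrite permKV -in_setC.
rewrite young_symE -/B -!mulmxA.
have ->: row_sum aG row_of *m (aG w *m E) = \sum_(p in R) aG (p * w)%g *m E.
  rewrite mulmx_suml; apply: eq_bigr => p _.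
  by rewrite mulmxA -repr_mxM ?inE.
by rewrite (mulmx_sumr B) big1 ?mulmx0.
Qed.

(** Here two boxes of a common row are always sent into [K], where the row sum
    meets the sign of a transposition. *)
Lemma cfdot_specht_row K N : (forall x, row_of x < N)%N -> (N < #|K|)%N ->
  '[specht_cfun, set_sign_ind K] = 0.
Proof.
move=> ltrN ltNK; apply: cfdot_specht_eq0 => w.
have [||x [y [Kx Ky ne_xy rxy]]] := @pigeonhole T (fun x => row_of (w^-1 x)%g) N K.
- by [].
- by [].
rewrite young_symE -!mulmxA [row_sum _ _ *m _]mulmxA.
rewrite (@row_sum_set_sign_sum0 _ _ _ _ _ (w^-1 x)%g (w^-1 y)%g) ?mulmx0 ?permKV //.
by rewrite (inj_eq perm_inj).
Qed.

Lemma cfdot_specht_neq0 K (v : 'rV_#|G|) :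
    (v <= specht_mod)%MS -> v != 0 ->
    (forall h, h \in set_stab K -> v *m aG h = set_sign K h *: v) ->
  '[specht_cfun, set_sign_ind K] != 0.
Proof.
move=> Vv nz_v vK; rewrite -cfdot_Res_l.
apply: (@cfdot_Res_lin_neq0 _ _ _ _ _ _ _ _ (in_submod specht_mod v)).
- exact: subsetT.
- exact: set_sign_lin_char.
- apply: contraNneq nz_v => v0; rewrite -(in_submodK Vv) v0 linear0 //.
move=> h Kh; rewrite set_sign_cfunE Kh mulr1n -linearZ /= -vK //.
by rewrite (in_submodJ (cyclic_mx_module aG young_sym)).
Qed.

End SpechtModule.

End YoungModules.

(** * Hook shapes *)

Section HookModule.

Variables (T : finType) (row_of col_of : T -> nat) (arm leg : {set T}) (o : T).
Let G : {group {perm T}} := [set: {perm T}]%G.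
Local Notation aG := (regular_repr algC G).
Local Notation R := (fiber_stab row_of).
Local Notation C := (fiber_stab col_of).
Local Notation A := (row_sum aG row_of).
Local Notation B := (signed_sum aG col_of).
Local Notation c := (young_sym row_of col_of).
Local Notation V := (specht_mod row_of col_of).

Hypothesis rowP : forall s, (s \in R) = perm_on arm s.
Hypothesis colP : forall s, (s \in C) = perm_on leg s.
Hypothesis armI : arm :&: leg = [set o].
Hypothesis armU : arm :|: leg = setT.

Let arm_o : o \in arm.
Proof. by have /setIP[] : o \in arm :&: leg by rewrite armI inE. Qed.
Let leg_o : o \in leg.
Proof. by have /setIP[] : o \in arm :&: leg by rewrite armI inE. Qed.

Let notarm x : (x \notin arm) = (x != o) && (x \in leg).
Proof.
have := in_setU x arm leg; rewrite armU inE => /esym.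
have := in_setI x arm leg; rewrite armI inE => ->.
by case: (x \in arm); case: (x \in leg).
Qed.

Let notleg x : (x \notin leg) = (x != o) && (x \in arm).
Proof.
have := in_setU x arm leg; rewrite armU inE => /esym.
have := in_setI x arm leg; rewrite armI inE => ->.
by case: (x \in arm); case: (x \in leg).
Qed.

Lemma hook_row_col1 s : s \in R -> s \in C -> s = 1%g.
Proof.
rewrite rowP colP => sA sL; apply: (@perm_on_id _ _ [set o]); last by rewrite cards1.
by apply/subsetP => x s_x; rewrite -armI inE (subsetP sA) ?(subsetP sL).
Qed.

Lemma hook_young_sym_col q : q \in C -> c 0 (gring_index G q) = (-1) ^+ q.
Proof.
move=> Cq; rewrite young_sym_coef (bigD1 1%g) ?group1 //= (bigD1 q) //=.
rewrite mulg1 eqxx mulr1n !big1 ?addr0 // => [p|q'] /andP[Rp ne]; last first.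
  by rewrite mulg1 eq_sym (negPf ne).
apply: big1 => q' Cq'.
case: eqP => // Eq; case/eqP: ne; apply: hook_row_col1 => //.
by rewrite -(mulKg q' p) -Eq groupM ?groupV.
Qed.

(** If at most one point of the leg goes to the arm, then exactly one does, since
    the complement of the arm has one point less than the leg.  Sending that point
    to the corner and the others where [w] sends them is a column permutation, and
    what remains of [w] permutes the arm. *)
Lemma hook_factor (w : {perm T}) :
  (exists x y, [/\ x \in leg, y \in leg, x != y, w x \in arm & w y \in arm]) \/
  (exists q p, [/\ q \in C, p \in R & w = (q * p)%g]).
Proof.
case: (pickP [pred x in leg | w x \in arm]) => [x0 /andP[Lx0 Aw0]|noA]; last first.
  have /subset_leq_card: w @: leg \subset leg :\ o.
    apply/subsetP => _ /imsetP[x Lx ->]; rewrite !inE -notarm.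
    by have /= := noA x; rewrite Lx /= => ->.
  by rewrite card_imset; [rewrite (cardsD1 o leg) leg_o ltnn | apply: perm_inj].
case: (pickP [pred x in leg | (x != x0) && (w x \in arm)]) => [x /and3P[Lx ne Ax]|uniqA].
  by left; exists x, x0.
right; have wL x : x \in leg -> x != x0 -> w x \notin arm.
  by move=> Lx ne; have /= := uniqA x; rewrite Lx ne /= => ->.
(* [q] agrees with [w] on the leg, except that [x0] goes to the corner. *)
pose f x := if x == x0 then o else if x \in leg then w x else x.
have [|q qE] := @perm_extend T setT f.
  move=> x y _ _; rewrite /f; case: eqVneq => [->|nx]; case: eqVneq => [->|ny] //.
  - case: ifP => [Ly E|/negbT]; last by move=> Ly E; rewrite -E leg_o in Ly.
    by have:= wL _ Ly ny; rewrite -E arm_o.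
  - case: ifP => [Lx E|/negbT]; last by move=> Lx E; rewrite E leg_o in Lx.
    by have:= wL _ Lx nx; rewrite E arm_o.
  case: ifP => [Lx|/negbT Lx]; case: ifP => [Ly|/negbT Ly] //.
  - exact: perm_inj.
  - by move=> E; have:= wL _ Lx nx; rewrite E; case/andP: (etrans (esym (notleg y)) Ly) => _ ->.
  - by move=> E; have:= wL _ Ly ny; rewrite -E; case/andP: (etrans (esym (notleg x)) Lx) => _ ->.
exists q, (q^-1 * w)%g; split; last by rewrite mulKVg.
  rewrite colP; apply/subsetP => x; rewrite inE qE ?inE //; apply: contraR => Lx.
  rewrite /f (negPf Lx); case: (x =P x0) => [E|_]; last exact: eqxx.
  by rewrite E Lx0 in Lx.
rewrite rowP; apply/subsetP => y; rewrite inE permM; apply: contraR => Ay.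
have: q (q^-1 y)%g = y by apply: permKV.
rewrite qE ?inE // /f; case: eqP => [_ E|_]; first by rewrite -E arm_o in Ay.
case: ifP => [_ -> // |/negbT Lx E]; rewrite notarm in Ay.
by case/andP: Ay => _; rewrite -E (negPf Lx).
Qed.

(** Either a transposition of the leg becomes a transposition of the arm past [w],
    and the product is its own opposite, or [w] splits into a column and a row
    permutation that the two sums absorb. *)
Lemma hook_sandwich w : exists k : algC, B *m aG w *m A = k *: (B *m A).
Proof.
case: (hook_factor w) => [[x [y [Lx Ly ne Ax Ay]]]|[q [p [Cq Rp ->]]]]; last first.
  exists ((-1) ^+ q); rewrite repr_mxM ?inE // mulmxA signed_sum_mulr //.
  by rewrite -!mulmxA row_sum_mull // scalemxAl.
exists 0; rewrite scale0r; apply: eq_opp_mx0.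
set M := _ *m _; have Ct : tperm x y \in C.
  rewrite colP; apply/subsetP => z; rewrite inE; apply: contraR => Lz.
  by rewrite tpermD //; apply: contraNneq Lz => <-.
have := signed_sum_mulr aG Ct.
rewrite odd_tperm ne expr1 scaleN1r => /(congr1 -%R); rewrite opprK => EB.
rewrite {1}/M -[in LHS]EB !mulNmx -!mulmxA.
rewrite [aG (tperm _ _) *m (_ *m _)]mulmxA -repr_mxM ?inE //.
rewrite [(tperm x y * w)%g]conjgC repr_mxM ?inE // -[aG w *m _ *m _]mulmxA.
rewrite tpermJ row_sum_mull; first by rewrite mulmxA.
rewrite rowP; apply/subsetP => z; rewrite inE; apply: contraR => Az.
by rewrite tpermD //; apply: contraNneq Az => <-.
Qed.

(** A fixed vector is its own average over the row group, so it lies in the span of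
    the products evaluated in [hook_sandwich]. *)
Lemma hook_row_fixed (v : 'rV_#|G|) : (v <= V)%MS ->
  (forall p, p \in R -> v *m aG p = v) -> exists k : algC, v = k *: c.
Proof.
move=> /specht_modP[a Ev] vR; have nzR: #|R|%:R != 0 :> algC.
  by rewrite pnatr_eq0 -lt0n cardG_gt0.
have vA : v *m A = #|R|%:R *: v.
  rewrite mulmx_sumr (eq_bigr (fun=> v)) ?sumr_const -?scaler_nat //.
suffices [k Ek]: exists k : algC, v *m A = k *: c.
  exists (#|R|%:R^-1 * k); rewrite -scalerA -Ek vA scalerA mulVf ?scale1r //.
have cwA w : exists k : algC, c *m aG w *m A = k *: c.
  rewrite young_symE.
  suffices [k Ek]: exists k : algC, B *m (A *m aG w *m A) = k *: (B *m A).
    by exists k; rewrite -!mulmxA in Ek *; rewrite Ek -scalemxAr.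
  have ->: A *m aG w *m A = \sum_(p in R) aG (p * w)%g *m A.
    rewrite {1}/row_sum !mulmx_suml; apply: eq_bigr => p _; by rewrite repr_mxM ?inE.
  rewrite (mulmx_sumr B).
  elim/big_ind: _ => [|M N [k ->] [l ->]|p _]; first by exists 0; rewrite scale0r.
    by exists (k + l); rewrite scalerDl.
  by rewrite mulmxA; apply: hook_sandwich.
rewrite Ev mulmx_suml; elim/big_ind: _ => [|M N [k ->] [l ->]|w _].
- by exists 0; rewrite scale0r.
- by exists (k + l); rewrite scalerDl.
by have [k Ek] := cwA w; exists (a w * k); rewrite -scalemxAl Ek scalerA.
Qed.

Lemma hook_young_sym_neq0 : c != 0.
Proof.
apply: contra_eq_neq (hook_young_sym_col (group1 _)) => ->.
by rewrite mxE odd_perm1 eq_sym oner_eq0.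
Qed.

Lemma hook_row_sym p : p \in R -> c *m aG p = c.
Proof. by move=> Rp; rewrite young_symE -!mulmxA row_sum_mulr. Qed.

(** By complete reducibility the generator splits along any submodule and a
    complement.  Both components are fixed by the row group, hence multiples of
    the generator; one is nonzero and generates everything. *)
Lemma hook_specht_simple : mxsimple aG V.
Proof.
split=> [||U modU sUV nzU]; first exact: cyclic_mx_module.
  by rewrite cyclic_mx_eq0 hook_young_sym_neq0.
have redV : mx_completely_reducible aG V.
  apply: mx_reducibleS (submx1 _) _; first exact: cyclic_mx_module.
  by apply: mx_Maschke_pchar; rewrite /pgroup pcharf'_nat pnatr_eq0 -lt0n cardG_gt0.
have [W modW defV dxUW] := redV U modU sUV.
have sWV : (W <= V)%MS by rewrite -defV addsmxSr.
have /sub_addsmxP[[x y] /= Ec] : (c <= U + W)%MS by rewrite defV cyclic_mx_id.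
have split_fixed p : p \in R ->
    x *m U *m aG p = x *m U /\ y *m W *m aG p = y *m W.
  move=> Rp; have Up : (x *m U *m aG p <= U)%MS.
    by apply: submx_trans (submxMr _ (submxMl _ _)) _; apply: (mxmoduleP modU); rewrite inE.
  have Wp : (y *m W *m aG p <= W)%MS.
    by apply: submx_trans (submxMr _ (submxMl _ _)) _; apply: (mxmoduleP modW); rewrite inE.
  (* As [p] fixes the sum of the two components, it changes them by opposite
     vectors, which then lie in both [U] and [W]. *)
  have E0 : x *m U *m aG p - x *m U = y *m W - y *m W *m aG p.
    apply/eqP; rewrite subr_eq addrAC eq_sym subr_eq addrC -Ec.
    by rewrite -mulmxDl -Ec hook_row_sym.
  have : (x *m U *m aG p - x *m U <= U :&: W)%MS.
    rewrite sub_capmx {2}E0 !addmx_sub ?Up ?Wp // ?eqmx_opp ?submxMl //.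
  rewrite (mxdirect_addsP dxUW) submx0 subr_eq0 => /eqP EU.
  split=> //; apply/eqP; rewrite eq_sym -subr_eq0 -E0 EU subrr //.
have [k Ek] : exists k : algC, x *m U = k *: c.
  apply: hook_row_fixed => [|p /split_fixed[] //].
  exact: submx_trans (submxMl _ _) sUV.
have [l El] : exists l : algC, y *m W = l *: c.
  apply: hook_row_fixed => [|p /split_fixed[] //].
  exact: submx_trans (submxMl _ _) sWV.
have [k0|nzk] := eqVneq k 0; last first.
  apply: cyclic_mx_sub => //; have ->: c = k^-1 *: (x *m U).
    by rewrite Ek scalerA mulVf ?scale1r.
  by rewrite scalemx_sub ?submxMl.
have nzl : l != 0.
  apply: contraNneq hook_young_sym_neq0 => l0.
  by rewrite Ec Ek El k0 l0 !scale0r addr0.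
case/eqP: nzU; apply/eqP; rewrite -submx0 -(mxdirect_addsP dxUW) sub_capmx submx_refl /=.
apply: submx_trans sUV _; apply: cyclic_mx_sub => //.
have ->: c = l^-1 *: (y *m W) by rewrite El scalerA mulVf ?scale1r.
by rewrite scalemx_sub ?submxMl.
Qed.

Lemma hook_specht_irr : specht_cfun row_of col_of \in irr G.
Proof.
apply/irr_reprP; exists (Representation (submod_repr (cyclic_mx_module aG c))) => //.
by apply/submod_mx_irr; apply: hook_specht_simple.
Qed.

Lemma hook_row_sum_comm s : perm_on (~: arm) s -> A *m aG s = aG s *m A.
Proof.
move=> Ks; rewrite mulmx_suml mulmx_sumr; apply: eq_bigr => p.
rewrite rowP => Ap; rewrite -!repr_mxM ?inE //; congr (aG _).
by apply: perm_onC Ap Ks _; rewrite -setI_eq0 setICr.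
Qed.

Lemma hook_signed_sum_comm s : perm_on (~: leg) s -> B *m aG s = aG s *m B.
Proof.
move=> Ks; rewrite mulmx_suml mulmx_sumr; apply: eq_bigr => p.
rewrite colP => Ap; rewrite -scalemxAl -scalemxAr -!repr_mxM ?inE //.
congr (_ *: aG _).
by apply: perm_onC Ap Ks _; rewrite -setI_eq0 setICr.
Qed.

Lemma sub_leg : ~: arm \subset leg.
Proof. by apply/subsetP => x; rewrite inE notarm => /andP[]. Qed.

Lemma sub_arm : ~: leg \subset arm.
Proof. by apply/subsetP => x; rewrite inE notleg => /andP[]. Qed.

(** The generator itself transforms by the sign of the complement of the arm: that
    complement lies in the leg, and the rest of its stabilizer permutes the
    arm. *)
Lemma cfdot_hook_notarm : '[specht_cfun row_of col_of, set_sign_ind (~: arm)] != 0.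
Proof.
apply: (cfdot_specht_neq0 (cyclic_mx_id _ _) hook_young_sym_neq0) => h.
case/set_stab_split => s1 [s2 [s1K s2K -> ->]].
have Cs1: s1 \in C by rewrite colP (perm_onS sub_leg).
have Rs2: s2 \in R by rewrite rowP -[arm]setCK.
rewrite young_symE repr_mxM ?inE // -!mulmxA (mulmxA A) hook_row_sum_comm //.
rewrite -mulmxA row_sum_mulr // (mulmxA B) signed_sum_mulr // -scalemxAl.
by rewrite -scalemxAr.
Qed.

(** Symmetrizing the generator once more over the column group gives a vector that
    transforms by the sign of the leg.  It is nonzero because its coefficient at
    the identity is the order of the column group. *)
Lemma cfdot_hook_leg : '[specht_cfun row_of col_of, set_sign_ind leg] != 0.
Proof.
have Ec : c *m B = \sum_(q in C) (-1) ^+ q *: (c *m aG q).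
  by rewrite mulmx_sumr; apply: eq_bigr => q _; rewrite scalemxAr.
apply: (@cfdot_specht_neq0 _ _ _ _ (c *m B)) => [||h].
- rewrite Ec summx_sub // => q _; rewrite scalemx_sub // specht_mod_mulr //.
  exact: cyclic_mx_id.
- have: (c *m B) 0 (gring_index G 1) != 0.
    rewrite Ec summxE (eq_bigr (fun=> 1)) => [|q Cq].
      by rewrite sumr_const pnatr_eq0 -lt0n cardG_gt0.
    rewrite mxE regular_coef mul1g hook_young_sym_col ?groupV //.
    by rewrite odd_permV -expr2 sqrr_sign.
  by apply: contraNneq => ->; rewrite mxE.
case/set_stab_split => s1 [s2 [s1K s2K -> ->]].
have Cs1: s1 \in C by rewrite colP.
have Rs2: s2 \in R by rewrite rowP (perm_onS sub_arm).
rewrite repr_mxM ?inE // -!mulmxA (mulmxA B) signed_sum_mulr // -scalemxAl.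
rewrite hook_signed_sum_comm // -scalemxAr; congr (_ *: _).
by rewrite mulmxA hook_row_sym.
Qed.

(** A product of a column and a row permutation that fixes the corner does so
    factor by factor, and then each factor preserves the arm. *)
Lemma hook_young_sym_support (h : {perm T}) : h o = o ->
  young_sym row_of col_of 0 (gring_index G h) != 0 ->
  forall x, (h x \in arm) = (x \in arm).
Proof.
move=> ho nz_h; have /existsP[q /andP[Cq /existsP[p /andP[Rp /eqP Eh]]]] :
    [exists q : {perm T}, (q \in C) && [exists p : {perm T}, (p \in R) && (h == q * p)%g]].
  apply: contraNT nz_h => /existsPn noqp; rewrite young_sym_coef.
  rewrite big1 // => p Rp; rewrite big1 // => q Cq.
  have:= noqp q; rewrite Cq /= => /existsPn/(_ p); rewrite Rp /= => /negPf ->.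
  by rewrite mulr0n.
rewrite colP in Cq; rewrite rowP in Rp.
have qo : q o = o.
  apply: contraTeq (eqxx (h o)) => nqo; rewrite {2}ho Eh permM (out_perm Rp) //.
  by rewrite notarm nqo perm_closed.
move=> x; rewrite Eh permM; have [Ax|A'x] := boolP (x \in arm).
  rewrite perm_closed //; have [->|nxo] := eqVneq x o; first by rewrite qo.
  by rewrite (out_perm Cq) // notleg nxo.
apply/negbTE; move: A'x; rewrite notarm => /andP[nxo Lx].
have A'q : q x \notin arm.
  by rewrite notarm perm_closed // Lx -[X in _ != X]qo (inj_eq perm_inj) nxo.
by rewrite (out_perm Rp).
Qed.

(** For a set [S] of [#|~: arm|] points other than the corner, choose [v S] that
    fixes the corner and carries the complement of the arm onto [S].  The
    coefficient of the translate by [v S] at [v S'] is 1 if [S = S'] and 0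
    otherwise, by [hook_young_sym_support], so these translates are
    independent. *)
Lemma hook_specht_degree :
  'C(#|T|.-1, #|~: arm|)%:R <= specht_cfun row_of col_of 1%g.
Proof.
rewrite cfRepr1 ler_nat.
have -> : #|T|.-1 = #|~: [set o]| by rewrite cardsC1.
rewrite -cards_draws; set F := [set S | _].
pose v (S : {set T}) : {perm T} := odflt 1%g
  [pick y : {perm T} | (y o == o) && [forall x, (y x \in S) == (x \in ~: arm)]].
have vP (S : {set T}) : S \in F -> v S o = o /\ forall x, (v S x \in S) = (x \in ~: arm).
  rewrite inE => /andP[So /eqP cS]; rewrite /v; case: pickP => [y /andP[/eqP yo /forallP yS]|no].
    by split=> // x; apply/eqP.
  have [y yP] := perm_map_set (esym cS).
  case/negP: (negbT (no (y * tperm (y o) o)%g)).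
  rewrite permM tpermL eqxx; apply/forallP => x; rewrite -yP permM.
  have So' : o \notin S by have := subsetP So o; rewrite !inE eqxx; case: (o \in S) => // /(_ isT).
  have Syo : y o \notin S by rewrite yP inE arm_o.
  by case: tpermP => [->|->|//]; rewrite (negPf So') (negPf Syo).
pose M : 'M[algC]_(#|F|, #|G|) := \matrix_i (c *m aG (v (enum_val i))).
pose P : 'M[algC]_(#|G|, #|F|) :=
  \matrix_(x, j) (x == gring_index G (v (enum_val j)))%:R.
have MP : M *m P = 1%:M.
  apply/matrixP => i j; rewrite mxE (bigD1 (gring_index G (v (enum_val j)))) //=.
  rewrite big1 => [|x /negPf ne]; last by rewrite !mxE ne mulr0.
  rewrite [P _ _]mxE eqxx mulr1 addr0 /M mxE regular_coef [RHS]mxE.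
  case: eqVneq => [->|ne_ij]; first by rewrite mulgV hook_young_sym_col ?group1 // odd_perm1.
  apply/eqP; apply: contraNT ne_ij => nz.
  have [vio viS] := vP _ (enum_valP i); have [vjo vjS] := vP _ (enum_valP j).
  have hA := hook_young_sym_support _ nz.
  apply/eqP/enum_val_inj/setP => z.
  have [t ->] : exists t, z = v (enum_val j) t.
    by exists ((v (enum_val j))^-1%g z); rewrite permKV.
  rewrite vjS inE -hA; last by rewrite permM vjo -{1}vio permK.
  by rewrite -in_setC -viS permM permKV.
have sMV : (M <= V)%MS.
  by apply/row_subP => i; rewrite rowK specht_mod_mulr ?cyclic_mx_id.
apply: leq_trans (mxrankS sMV); rewrite -[X in (X <= _)%N](mxrank1 algC) -MP.
exact: mxrankM_maxl.
Qed.

End HookModule.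

Lemma reshape_index_cons n s i :
  reshape_index (n :: s) i = if (i < n)%N then 0%N else (reshape_index s (i - n)).+1.
Proof.
rewrite /reshape_index /= subn_eq0; case: ltnP => // leni.
by rewrite subSn.
Qed.

Lemma reshape_offset_cons n s i :
  reshape_offset (n :: s) i = if (i < n)%N then i else reshape_offset s (i - n).
Proof.
rewrite /reshape_offset reshape_index_cons; case: ltnP => _; first by rewrite subn0.
by rewrite /= subnDA.
Qed.

Lemma reshape_index_nseq1 k i : (i < k)%N -> reshape_index (nseq k 1%N) i = i.
Proof.
elim: k i => // k IHk [|i] ltik; rewrite /= reshape_index_cons //.
by rewrite subn1 IHk.
Qed.

Lemma reshape_offset_nseq1 k i : (i < k)%N -> reshape_offset (nseq k 1%N) i = 0%N.
Proof.
elim: k i => // k IHk [|i] ltik; rewrite /= reshape_offset_cons //.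
by rewrite subn1 IHk.
Qed.

Definition hook_part (d k : nat) : seq nat := (d - k)%N :: nseq k 1%N.

Section HookShape.

Variables (d k : nat).
Hypothesis ltkd : (k < d)%N.

Let arm : {set 'I_d} := [set x : 'I_d | (x < d - k)%N].
Let leg : {set 'I_d} := [set x : 'I_d | (x == 0%N :> nat) || (d - k <= x)%N].
Let o : 'I_d := Ordinal (leq_ltn_trans (leq0n k) ltkd).
Let row_of (x : 'I_d) := reshape_index (hook_part d k) x.
Let col_of (x : 'I_d) := reshape_offset (hook_part d k) x.

Let row_ofE x : row_of x = if (x < d - k)%N then 0%N else (x - (d - k)).+1.
Proof.
rewrite /row_of reshape_index_cons; case: ltnP => // le_x.
by rewrite reshape_index_nseq1 // ltn_subLR // subnK ?ltn_ord // ltnW.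
Qed.

Let col_ofE x : col_of x = if (x < d - k)%N then x : nat else 0%N.
Proof.
rewrite /col_of reshape_offset_cons; case: ltnP => // le_x.
by rewrite reshape_offset_nseq1 // ltn_subLR // subnK ?ltn_ord // ltnW.
Qed.

Let rowP s : (s \in fiber_stab row_of) = perm_on arm s.
Proof.
apply/fiber_stabP/subsetP => [rs x | As x].
  rewrite !inE; apply: contraR => Ax; have := rs x; rewrite !row_ofE (negPf Ax).
  rewrite -leqNgt in Ax; case: ltnP => // le_sx [E]; apply/eqP/val_inj => /=.
  by rewrite -(subnK Ax) -E subnK.
rewrite !row_ofE; have [lt_x|le_x] := ltnP x (d - k).
  by have := perm_closed x (introT subsetP As); rewrite !inE lt_x => ->.
rewrite (out_perm (introT subsetP As)) ?inE -?leqNgt //.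
by rewrite ltnNge le_x.
Qed.

Let colP s : (s \in fiber_stab col_of) = perm_on leg s.
Proof.
apply/fiber_stabP/subsetP => [cs x | Ls x].
  rewrite !inE; apply: contraR; rewrite negb_or -ltnNge -lt0n => /andP[x0 lt_x].
  have := cs x; rewrite !col_ofE lt_x; case: ltnP => _ E; last by rewrite -E in x0.
  exact/eqP/val_inj.
rewrite !col_ofE; have [Lx|Lx] := boolP (x \in leg); last first.
  by rewrite (out_perm (introT subsetP Ls)).
have L0 y : y \in leg -> (if (y < d - k)%N then y : nat else 0%N) = 0%N.
  by rewrite inE => /orP[/eqP->|]; [case: ifP | rewrite ltnNge => ->].
by rewrite !L0 ?(perm_closed _ (introT subsetP Ls)).
Qed.

Let armI : arm :&: leg = [set o].
Proof.
apply/setP => x; rewrite !inE -val_eqE /= [(d - k <= _)%N]leqNgt.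
by case: eqP => [->|_]; rewrite ?subn_gt0 ?ltkd //= andbN.
Qed.

Let armU : arm :|: leg = setT.
Proof. by apply/setP => x; rewrite !inE; case: ltnP; rewrite ?orbT. Qed.

Let card_notarm : #|~: arm| = k.
Proof.
apply/eqP; rewrite -(eqn_add2l #|arm|) cardsC card_ord card_ord_lt ?leq_subr //.
by rewrite subnK // ltnW.
Qed.

Let card_leg : #|leg| = k.+1.
Proof.
have:= cardsUI arm leg; rewrite armU armI cards1 cardsT card_ord card_ord_lt ?leq_subr //.
move/eqP; rewrite -{1}(subnK (ltnW ltkd)) -addnA eqn_add2l addn1 => /eqP <- //.
Qed.

Lemma hook_char_irr : specht_char d (hook_part d k) \in irr [set: 'S_d]%G.
Proof. exact: (hook_specht_irr rowP colP armI armU). Qed.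

Lemma cfdot_hook_char_ind (K : {set 'I_d}) :
  #|K| = k -> '[specht_char d (hook_part d k), set_sign_ind K] != 0.
Proof.
move=> cK; rewrite (@eq_set_sign_ind _ _ (~: arm)) ?card_notarm //.
exact: (cfdot_hook_notarm rowP colP armI armU).
Qed.

Lemma cfdot_hook_char_indS (K : {set 'I_d}) :
  #|K| = k.+1 -> '[specht_char d (hook_part d k), set_sign_ind K] != 0.
Proof.
move=> cK; rewrite (@eq_set_sign_ind _ _ leg) ?card_leg //.
exact: (cfdot_hook_leg rowP colP armI armU).
Qed.

Lemma hook_char_degree : 'C(d.-1, k)%:R <= specht_char d (hook_part d k) 1%g.
Proof.
have := hook_specht_degree rowP colP armI armU.
by rewrite card_notarm card_ord.
Qed.

End HookShape.

(** * Characters of hooks *)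

Lemma specht_char_char d la : specht_char d la \is a character.
Proof. exact: cfRepr_char. Qed.

(** The shorter hook has too few rows for the sign of a set as large as the leg of
    the longer one. *)
Lemma hook_char_inj d k l : (k < d)%N -> (l < d)%N ->
  specht_char d (hook_part d k) = specht_char d (hook_part d l) -> k = l.
Proof.
wlog ltkl : k l / (k < l)%N => [IH ltk ltl E|ltkd ltld E].
  by have [/IH|/IH|] := ltngtP k l; [apply | move/(_ ltl ltk (esym E)) |].
have cK := card_ord_lt ltld; have := cfdot_hook_char_indS ltld cK.
rewrite -E => /eqP[]; apply: (@cfdot_specht_row _ _ _ _ k.+1); last by rewrite cK.
move=> x; have := @reshape_indexP (hook_part d k) x.
by rewrite /= size_nseq sumn_nseq mul1n subnK ?ltn_ord; [apply|apply: ltnW].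
Qed.

(** The characters on the right are distinct irreducible constituents of the left
    side, and their degrees already exhaust it. *)
Lemma hook_char_branch d k (K : {set 'I_d}) : (k.+1 < d)%N -> #|K| = k.+1 ->
  set_sign_ind K = specht_char d (hook_part d k.+1) + specht_char d (hook_part d k).
Proof.
move=> ltkd cK; have ltkd' := ltnW ltkd.
have irr1 := hook_char_irr ltkd; have irr0 := hook_char_irr ltkd'.
have [phi Nphi Ephi] := constituent_split (set_sign_ind_char K) irr1 (cfdot_hook_char_ind ltkd cK).
have dot0 : '[specht_char d (hook_part d k), phi] != 0.
  have := cfdot_hook_char_indS ltkd' cK; rewrite Ephi cfdotDr.
  case/irrP: irr1 (irr0) => i1 E1 /irrP[i0 E0]; rewrite {1}E0 E1 cfdot_irr.
  case: (eqVneq i0 i1) => [Ei|_]; last by rewrite add0r.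
  have /eqP := hook_char_inj ltkd' ltkd (etrans E0 (etrans (congr1 _ Ei) (esym E1))).
  by rewrite eqn_leq ltnn andbF.
have [psi Npsi Epsi] := constituent_split Nphi irr0 dot0.
rewrite Ephi Epsi; suffices ->: psi = 0 by rewrite addr0.
apply: char_le0_eq0 => //.
have : set_sign_ind K 1%g = 'C(d, k.+1)%:R.
  by rewrite set_sign_ind_degree card_ord ?cK //; apply: leq_trans ltkd.
rewrite Ephi Epsi !cfunDE.
have := hook_char_degree ltkd; have := hook_char_degree ltkd'.
rewrite -[in 'C(d, _)](ltn_predK ltkd) binS natrD => le0 le1 E.
have -> : psi 1%g = 'C(d.-1, k.+1)%:R - specht_char d (hook_part d k.+1) 1%g
   + ('C(d.-1, k)%:R - specht_char d (hook_part d k) 1%g).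
  by rewrite addrACA -E; ring.
by rewrite -[0](addr0 0) lerD // subr_le0.
Qed.

Lemma hook_char_row d (K : {set 'I_d}) : (0 < d)%N -> #|K| = 0%N ->
  set_sign_ind K = specht_char d (hook_part d 0).
Proof.
move=> ltkd cK.
have [phi Nphi Ephi] := constituent_split (set_sign_ind_char K) (hook_char_irr ltkd)
  (cfdot_hook_char_ind ltkd cK).
rewrite Ephi; suffices ->: phi = 0 by rewrite addr0.
apply: char_le0_eq0 => //; have := hook_char_degree ltkd.
have : set_sign_ind K 1%g = 'C(d, 0)%:R.
  by rewrite set_sign_ind_degree card_ord ?cK.
rewrite Ephi cfunDE !bin0 => <-.
by rewrite gerDl.
Qed.

Lemma hook_char1 d k : (k < d)%N ->
  specht_char d (hook_part d k) 1%g = 'C(d.-1, k)%:R.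
Proof.
elim: k => [|k IHk] ltkd.
  by rewrite -(hook_char_row (K := set0)) ?cards0 // set_sign_ind_degree card_ord ?cards0 ?bin0.
have cK := card_ord_lt (ltnW ltkd); set K := [set x | _] in cK.
have := congr1 (fun phi : 'CF(_) => phi 1%g) (hook_char_branch ltkd cK).
rewrite cfunDE IHk ?(ltnW ltkd) // set_sign_ind_degree card_ord ?(leq_trans _ ltkd) // cK.
by rewrite -[in 'C(d, _)](ltn_predK ltkd) binS natrD => /addIr.
Qed.

Lemma natr_ffact n m : (n ^_ m)%:R = \prod_(i < m) (n%:R - i%:R) :> algC.
Proof.
elim: m => [|m IHm]; first by rewrite big_ord0 ffactn0.
rewrite big_ord_recr /= -IHm ffactnSr natrM; have [lemn|ltnm] := leqP m n.
  by rewrite natrB.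
by rewrite ffact_small // !mul0r.
Qed.

Lemma gbinom_nat n m : gbinom n%:R (Posz m) = 'C(n, m)%:R.
Proof.
rewrite /gbinom -natr_ffact -bin_ffact natrM mulfK //.
by rewrite pnatr_eq0 -lt0n fact_gt0.
Qed.

(** Pascal's rule for all integers [k] and all [x] is what makes the formula for
    the characters of hooks uniform, the full cycle with [x = -1] included. *)
Lemma gbinom_pascal x k : gbinom (x + 1) k = gbinom x k + gbinom x (k - 1).
Proof.
case: k => [[|m]|m] /=.
- by rewrite !big_ord0 addr0.
- rewrite subn1 /=.
  rewrite big_ord_recl big_ord_recr /= factS natrM subr0.
  under eq_bigr => i _ do rewrite /bump /= add1n -natr1 opprD addrACA subrr addr0.
  set P := \prod_(i < m) _.
  have nz : m`!%:R != 0 :> algC by rewrite pnatr_eq0 -lt0n fact_gt0.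
  have nz' : m.+1%:R != 0 :> algC by rewrite pnatr_eq0.
  by field; rewrite nz addrC natr1 nz'.
- by rewrite addr0.
Qed.

Lemma gbinomN1 k : gbinom (-1) (Posz k) = (-1) ^+ k.
Proof.
elim: k => [|k IHk]; first by rewrite /gbinom big_ord0 divr1.
have := gbinom_pascal (-1) k.+1; rewrite addNr -[0]/(0%:R) gbinom_nat bin0n mulr0n.
have -> : k.+1%:Z - 1 = k by rewrite -addn1 PoszD addrK.
rewrite IHk => /esym/eqP; rewrite addr_eq0 => /eqP ->.
by rewrite exprS mulN1r.
Qed.

(** Removing one cycle of length [j] from the cycle type leaves only fixed points.
    For [j = 1] the orbit is any point and [g] is the identity. *)
Lemma one_big_part_orbit d j (g : 'S_d) : (1 <= j <= d)%N ->
    g \in cycle_class d (one_big_part d j) ->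
  exists x, [/\ perm_on (porbit g x) g, #|porbit g x| = j
              & (-1) ^+ g = (-1) ^+ j.+1 :> algC].
Proof.
case/andP=> j0 lejd; rewrite inE /one_big_part => type_g.
have /mapP[J0] : j \in [seq #|pred_of_set J| | J <- enum (porbits g)].
  by rewrite (perm_mem type_g) mem_rcons mem_head.
rewrite mem_enum => /imsetP[x _ ->] Ej; exists x; split=> //; last first.
  have := perm_size type_g; rewrite size_map -cardE size_rcons size_nseq => Ec.
  rewrite -[RHS]signr_odd /odd_perm card_ord Ec !oddS oddB //.
  by case: (odd d); case: (odd j).
have Jg : porbit g x \in enum (porbits g) by rewrite mem_enum imset_f.
have ones : perm_eq [seq #|pred_of_set J| | J <- rem (porbit g x) (enum (porbits g))]
    (nseq (d - j) 1%N).
  have : perm_eq [seq #|pred_of_set J| | J <- porbit g x :: rem (porbit g x) (enum (porbits g))]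
      (j :: nseq (d - j) 1%N).
    apply: (@perm_trans _ [seq #|pred_of_set J| | J <- enum (porbits g)]).
      by apply: perm_map; rewrite perm_sym perm_to_rem.
    by apply: perm_trans type_g _; rewrite perm_rcons.
  by rewrite /= -Ej perm_cons.
apply/subsetP => y; rewrite inE; apply: contraR => J'y.
have : #|porbit g y| \in nseq (d - j) 1%N.
  rewrite -(perm_mem ones) map_f // mem_rem_uniq ?enum_uniq // inE mem_enum imset_f //.
  by rewrite andbT eq_porbit_mem.
rewrite mem_nseq => /andP[_ /cards1P[z Ez]].
have := porbit_id g y; have := mem_porbit g 1 y.
by rewrite expg1 Ez !inE => /eqP-> /eqP->.
Qed.

(** Induction on [k] by [hook_char_branch]: the value of the induced character is
    the same expression with [d - j] in place of [d - j - 1], and Pascal's rule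
    splits it into the terms for [k] and [k - 1]. *)
Lemma hook_char_value d k j (g : 'S_d) : (k < d)%N -> (1 <= j <= d)%N ->
    g \in cycle_class d (one_big_part d j) ->
  specht_char d (hook_part d k) g =
    gbinom (d%:R - j%:R - 1) k%:Z
      + (-1) ^+ j.+1 * gbinom (d%:R - j%:R - 1) (k%:Z - j%:Z).
Proof.
move=> ltkd bj /(one_big_part_orbit bj)[x [xg cJ sg]]; case/andP: bj => j0 lejd.
have cJ' : #|~: porbit g x| = (d - j)%N.
  by apply/eqP; rewrite -(eqn_add2l #|porbit g x|) cardsC card_ord cJ subnKC.
set X := d%:R - j%:R - 1; have EX : X + 1 = (d - j)%:R by rewrite subrK natrB.
have val_ind (l : nat) (K : {set 'I_d}) : (l <= d)%N -> #|K| = l ->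
    set_sign_ind K g = gbinom (X + 1) l%:Z + (-1) ^+ j.+1 * gbinom (X + 1) (l%:Z - j%:Z).
  move=> leld cK; rewrite (set_sign_ind_cycle K xg) cJ' sg cK EX gbinom_nat.
  have -> : #|~: K| = (d - l)%N.
    by apply/eqP; rewrite -(eqn_add2l #|K|) cardsC card_ord cK subnKC.
  congr (_ + _ * _); have [lejl|ltlj] := leqP j l.
    by rewrite subzn // gbinom_nat -[in RHS]bin_sub ?leq_sub2r // subnBA // subnK.
  rewrite bin_small ?ltn_sub2l // ?(leq_trans ltlj) //.
  by case E: (l%:Z - j%:Z) => [n|n] //; move: ltlj; rewrite -ltz_nat -subr_lt0 E.
elim: k ltkd => [|k IHk] ltkd.
  rewrite -(hook_char_row (K := set0)) ?cards0 // (val_ind 0%N) ?cards0 //.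
  rewrite !gbinom_pascal mulrDr; congr (_ + _); first by rewrite addr0.
  suffices -> : gbinom X (0%N%:Z - j%:Z - 1) = 0 by rewrite mulr0 addr0.
  by rewrite sub0r -opprD; case: (j) => [|n].
have cK := card_ord_lt (ltnW ltkd); set K := [set x | _] in cK.
have := congr1 (fun phi : 'CF(_) => phi g) (hook_char_branch ltkd cK).
rewrite (val_ind _ K (ltnW ltkd) cK) cfunDE IHk ?(ltnW ltkd) //.
rewrite !gbinom_pascal.
have -> : k.+1%:Z - 1 = k%:Z by rewrite -addn1 PoszD addrK.
have -> : k.+1%:Z - j%:Z - 1 = k%:Z - j%:Z by rewrite -addn1 PoszD addrAC addrK.
set a := gbinom _ _; set b := gbinom _ _; set c := gbinom _ _; set e := gbinom _ _.
by move/eqP; rewrite -subr_eq => /eqP <-; ring.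
Qed.

(** * Shapes that contain a hook constituent *)

Lemma partition_row_bounds d la (x : 'I_d) : is_partition d la ->
  (reshape_index la x < size la)%N && (reshape_offset la x < head 0%N la)%N.
Proof.
case/and3P => sla _ /eqP Ela; have ltx : (x < sumn la)%N by rewrite Ela.
have lti := reshape_indexP ltx; rewrite lti /=.
apply: leq_trans (reshape_offsetP ltx) _.
have geq_trans : transitive geq by move=> a b c le1 le2; apply: leq_trans le2 le1.
case: la sla {Ela ltx} lti => // n la /= sla; case: (reshape_index _ _) => //= i lti.
have := order_path_min geq_trans sla => /allP; apply; exact: mem_nth.
Qed.

(** The parts below the first are positive, so they add up to at least their
    number, with equality only if all of them are 1. *)
Lemma partition_eq_hook d la k : (k < d)%N -> is_partition d la ->
  (d - k <= head 0%N la)%N -> (k < size la)%N -> la = hook_part d k.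
Proof.
move=> ltkd; case: la => [|n la]; first by rewrite /= leqn0 subn_eq0 leqNgt ltkd.
case/and3P=> _; rewrite inE negb_or => /andP[_ la0] /eqP /= Ed len lek.
have [le_s E] : (size la <= sumn la)%N /\ (size la = sumn la -> la = nseq (size la) 1%N).
  elim: la la0 {Ed lek} => //= a la IH; rewrite inE negb_or eq_sym -lt0n => /andP[a0 /IH[le1 E1]].
  split; first by rewrite -add1n leq_add.
  move=> E; have [a1 Es] : a = 1%N /\ size la = sumn la by lia.
  by rewrite a1 [in LHS]E1.
have [n1 [s1 s2]] : n = (d - k)%N /\ size la = k /\ sumn la = k by lia.
by rewrite /hook_part -n1 -[in RHS]s1 -E // s1.
Qed.

(** The hook character is a constituent of the characters induced from sets of
    [k] and of [k + 1] points; a character that contains it meets both of them,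
    which bounds the number of columns and of rows of its shape from below. *)
Lemma hook_constituent d la k : is_partition d la -> (k < d)%N ->
  '[specht_char d la, specht_char d (hook_part d k)] != 0 -> la = hook_part d k.
Proof.
move=> part_la ltkd dot.
have bound := fun x : 'I_d => partition_row_bounds x part_la.
have [phi Nphi Ephi] : exists2 phi, phi \is a character &
    specht_char d la = specht_char d (hook_part d k) + phi.
  apply: constituent_split (specht_char_char d la) (hook_char_irr ltkd) _.
  by rewrite cfdotC fmorph_eq0.
have dotK (K : {set 'I_d}) : '[specht_char d (hook_part d k), set_sign_ind K] != 0 ->
    '[specht_char d la, set_sign_ind K] != 0.
  move=> nz; rewrite Ephi cfdotDl.
  have cfdot_ge0 chi : chi \is a character -> 0 <= '[chi, set_sign_ind K].
    by move=> Nchi; rewrite natr_ge0 // Cnat_cfdot_char // set_sign_ind_char.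
  rewrite paddr_eq0 ?cfdot_ge0 // ?specht_char_char //.
  by rewrite negb_and nz.
apply: partition_eq_hook => //.
  have cK := card_ord_lt (ltnW ltkd); set K := [set x | _] in cK.
  rewrite leqNgt; apply: contra (dotK K (cfdot_hook_char_ind ltkd cK)) => lt_la.
  apply/eqP; apply: (@cfdot_specht_col _ _ _ _ (head 0%N la)) => [x|].
    by case/andP: (bound x).
  suffices -> : #|~: K| = (d - k)%N by [].
  by apply/eqP; rewrite -(eqn_add2l #|K|) cardsC card_ord cK subnKC // ltnW.
have cK := card_ord_lt ltkd; set K := [set x | _] in cK.
rewrite ltnNge; apply: contra (dotK K (cfdot_hook_char_indS ltkd cK)) => le_la.
apply/eqP; apply: (@cfdot_specht_row _ _ _ _ (size la)) => [x|]; last by rewrite cK.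
by case/andP: (bound x).
Qed.

(** * Full cycles *)

Lemma full_cycleI d (s : 'S_d) x :
  (forall z, z \in porbit s x) -> s \in cycle_class d [:: d].
Proof.
move=> full; have Ex : porbit s x = setT by apply/setP => z; rewrite full inE.
rewrite inE; have -> : porbits s = [set setT].
  apply/setP => J; rewrite inE; apply/imsetP/eqP => [[y _ ->]|->]; last by exists x.
  by rewrite -Ex; apply/eqP; rewrite eq_porbit_mem full.
by rewrite enum_set1 /= cardsT card_ord.
Qed.

Lemma full_cycleE d (s : 'S_d) : (0 < d)%N -> s \in cycle_class d [:: d] ->
  exists x, forall z, z \in porbit s x.
Proof.
move=> d0; have -> : [:: d] = one_big_part d d by rewrite /one_big_part subnn.
case/(@one_big_part_orbit d d s) => [|x [_ cJ _]]; first by rewrite d0 leqnn.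
exists x => z; have : porbit s x == setT by rewrite eqEcard subsetT cardsT card_ord cJ leqnn.
by move/eqP->.
Qed.

Lemma full_cycleJ d (s y : 'S_d) : (0 < d)%N ->
  s \in cycle_class d [:: d] -> (s ^ y)%g \in cycle_class d [:: d].
Proof.
move=> d0 /(full_cycleE d0)[x full]; apply: (@full_cycleI d _ (y x)) => z.
have /porbitP[i Ei] := full ((y^-1)%g z); apply/porbitP; exists i.
by rewrite -conjXg permJ -Ei permKV.
Qed.

Lemma full_cycle_exists d : (0 < d)%N -> exists s, s \in cycle_class d [:: d].
Proof.
case: d => // d _; exists (perm (@ordS_inj d.+1)); apply: (@full_cycleI _ _ ord0) => z.
apply/porbitP; exists z; apply: val_inj; case: z => i lti /=.
elim: i lti => [|i IHi] lti; first by rewrite expg0 perm1.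
by rewrite expgSr permM permE /= -IHi ?modn_small // ltnW.
Qed.

(** A permutation that commutes with a full cycle is determined by its value at one
    point. *)
Lemma card_cent_full_cycle d (s : 'S_d) : (0 < d)%N -> s \in cycle_class d [:: d] ->
  (#|'C_[set: 'S_d][s]%g| <= d)%N.
Proof.
move=> d0 /(full_cycleE d0)[x full].
rewrite -[X in (_ <= X)%N](card_ord d).
have inj_x : {in 'C_[set: 'S_d][s]%g &, injective (fun g : 'S_d => g x)}.
  move=> g h /setIP[_ /cent1P gs] /setIP[_ /cent1P hs] Exy; apply/permP => z.
  have comm (u : 'S_d) i : commute u s -> u ((s ^+ i)%g x) = (s ^+ i)%g (u x).
    by move=> us; rewrite -!permM (commuteX i us).
  by have /porbitP[i ->] := full z; rewrite !comm ?Exy.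
by rewrite -(card_in_imset inj_x) max_card.
Qed.

Section FullCycles.

Variable d : nat.
Hypothesis d0 : (0 < d)%N.
Let G : {group 'S_d} := [set: 'S_d]%G.

Lemma hook_char_full_cycle k s : (k < d)%N -> s \in cycle_class d [:: d] ->
  specht_char d (hook_part d k) s = (-1) ^+ k.
Proof.
move=> ltkd; have -> : [:: d] = one_big_part d d by rewrite /one_big_part subnn.
move=> /(hook_char_value ltkd) -> //; last by rewrite d0 leqnn.
rewrite subrr sub0r gbinomN1.
suffices -> : gbinom (-1) (k%:Z - d%:Z) = 0 by rewrite mulr0 addr0.
by case E: (k%:Z - d%:Z) => [n|n] //; move: ltkd; rewrite -ltz_nat -subr_lt0 E.
Qed.

Let hook_irr (k : 'I_d) : Iirr G := cfIirr (specht_char d (hook_part d k)).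

Let hook_irrE k : 'chi_(hook_irr k) = specht_char d (hook_part d k).
Proof. by rewrite cfIirrE // hook_char_irr. Qed.

Let hook_irr_inj : injective hook_irr.
Proof.
move=> k l E; apply/val_inj/(@hook_char_inj d k l) => //.
by rewrite -!hook_irrE E.
Qed.

Let sum_hook_irr (F : Iirr G -> algC) :
  \sum_i F i = \sum_(k < d) F (hook_irr k) + \sum_(i | i \notin hook_irr @: 'I_d) F i.
Proof.
rewrite (bigID (mem (hook_irr @: 'I_d))) /= big_imset //=.
by move=> k l _ _; apply: hook_irr_inj.
Qed.

(** The hooks contribute 1 each to the sum of |chi(s)|^2 over the irreducible
    characters, and the bound on the centralizer leaves nothing for the others. *)
Lemma full_cycle_cent s : s \in cycle_class d [:: d] ->
  #|'C_G[s]%g| = d /\ forall i, i \notin hook_irr @: 'I_d -> 'chi_i s = 0.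
Proof.
move=> cs; have := second_orthogonality_relation s (in_setT s).
rewrite class_refl mulr1n sum_hook_irr.
under eq_bigr => k _ do rewrite hook_irrE hook_char_full_cycle // -normCK normr_sign expr1n.
rewrite sumr_const card_ord => E.
have ge0 i : 0 <= 'chi[G]_i s * ('chi_i s)^* by rewrite -normCK exprn_ge0.
have le_dC : d%:R <= #|'C_G[s]%g|%:R :> algC.
  by rewrite -E lerDl; apply: sumr_ge0 => i _; apply: ge0.
have Ec : #|'C_G[s]%g| = d.
  by apply/eqP; rewrite eqn_leq card_cent_full_cycle //= -(ler_nat algC).
split=> // i i_no; move: E; rewrite Ec -[RHS]addr0 => /addrI/eqP.
rewrite psumr_eq0 => [/allP/(_ i (mem_index_enum i))|i' _]; last exact: ge0.
by rewrite i_no mul_conjC_eq0 => /eqP.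
Qed.

Lemma nonhook_char_full_cycle la s : s \in cycle_class d [:: d] ->
    (forall k, (k < d)%N -> '[specht_char d la, specht_char d (hook_part d k)] = 0) ->
  specht_char d la s = 0.
Proof.
move=> cs ortho; rewrite [specht_char d la]cfun_sum_cfdot sum_cfunE big1 // => i _.
rewrite cfunE; have [/imsetP[k _ ->]|i_no] := boolP (i \in hook_irr @: 'I_d).
  by rewrite hook_irrE ortho ?mul0r.
by have [_ ->] := full_cycle_cent cs; rewrite ?mulr0.
Qed.

(** Two full cycles are conjugate because their columns in the character table have
    scalar product [d], which is not zero. *)
Lemma card_full_cycles : (#|cycle_class d [:: d]| * d)%N = d`!.
Proof.
have [s cs] := full_cycle_exists d0; have [cC zero] := full_cycle_cent cs.
have -> : cycle_class d [:: d] = (s ^: G)%g.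
  apply/setP => t; apply/idP/imsetP => [ct|[y _ ->]]; last exact: full_cycleJ.
  have := second_orthogonality_relation t (in_setT s).
  rewrite sum_hook_irr [X in _ + X]big1 => [|i i_no]; last by rewrite zero // conjC0 mulr0.
  rewrite addr0 (eq_bigr (fun=> 1)) => [|k _]; last first.
    by rewrite hook_irrE !hook_char_full_cycle // -normCK normr_sign expr1n.
  rewrite sumr_const card_ord; case: (boolP (t \in _)) => [/imsetP //|_] /eqP.
  by rewrite mulr0n pnatr_eq0 eqn0Ngt d0.
rewrite -index_cent1 -[X in (_ * X)%N]cC mulnC Lagrange ?subsetIl //.
by rewrite cardsT card_Sn.
Qed.

End FullCycles.

(** * Hook contents and shifted power sums of hooks *)

Lemma sum_sign_binS m (f : nat -> algC) :
  \sum_(k < m.+2) (-1) ^+ k * 'C(m.+1, k)%:R * f k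
  = \sum_(k < m.+1) (-1) ^+ k * 'C(m, k)%:R * (f k - f k.+1).
Proof.
transitivity (\sum_(k < m.+2) (-1) ^+ k * 'C(m, k)%:R * f k
    - \sum_(k < m.+1) (-1) ^+ k * 'C(m, k)%:R * f k.+1).
  rewrite ![\sum_(k < m.+2) _]big_ord_recl !bin0 -addrA; congr (_ + _).
  rewrite -sumrB; apply: eq_bigr => k _; rewrite !lift0 binS natrD exprS; ring.
rewrite big_ord_recr /= bin_small // mulr0 mul0r addr0 -sumrB.
by apply: eq_bigr => k _; rewrite mulrBr.
Qed.

(** An alternating sum of this kind is an iterated difference in [m], and one
    difference lowers the lower index of a binomial coefficient by 1. *)
Lemma sum_sign_bin m n d : (m <= d)%N ->
  \sum_(k < m.+1) (-1) ^+ k * 'C(m, k)%:R * ('C(m - k + n, d))%:R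
  = 'C(n, d - m)%:R :> algC.
Proof.
elim: m d => [|m IHm] d; first by rewrite big_ord_recl big_ord0 !mul1r addr0 subn0.
case: d => // d lemd; rewrite (sum_sign_binS m (fun k => 'C(m.+1 - k + n, d.+1)%:R)).
rewrite subSS -IHm //; apply: eq_bigr => k _; congr (_ * _).
by rewrite subSS subSn -1?ltnS // addSn binS natrD addrC addKr.
Qed.

Lemma p_hook d k i : (k < d)%N ->
  p_ i (hook_part d k) = (d%:R - k%:R - 2%:R^-1) ^+ i - (- k%:R - 2%:R^-1) ^+ i.
Proof.
move=> ltkd; rewrite /p_ /= size_nseq big_ord_recl /=.
pose f n : algC := (- n%:R - 2%:R^-1) ^+ i.
rewrite (eq_bigr (fun r : 'I_k => f r - f r.+1)) => [|r _]; last first.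
  rewrite -[bump 0 r]/(r.+1) /= nth_nseq ltn_ord /f.
  by congr (_ ^+ _ - _ ^+ _); field.
have -> : \sum_(r < k) (f r - f r.+1) = f 0%N - f k.
  elim: (k) => [|n IHn]; first by rewrite big_ord0 subrr.
  by rewrite big_ord_recr /= IHn addrA subrK.
rewrite natrB ?(ltnW ltkd) // /f addrA.
have -> : - 1%:R + 2%:R^-1 = - 0%:R - 2%:R^-1 :> algC by field.
by rewrite subrK; congr (_ ^+ _ - _); field.
Qed.

Lemma prod_p_hook d d' i k : (k < d)%N ->
  \prod_(l <- one_big_part d' i) p_ l (hook_part d k) =
  d%:R ^+ (d' - i) * p_ i (hook_part d k).
Proof.
move=> ltkd; rewrite /one_big_part -cats1 big_cat big_seq1 big_nseq /=; congr (_ * _).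
rewrite p_hook // !expr1 (_ : _ - _ - _ - _ = d%:R); last by ring.
by elim: (d' - i)%N => //= n ->; rewrite exprS.
Qed.

(** The contents of the hook are the consecutive integers from [- k] to [n], so the
    numerators form the falling factorial of [x + n] with [n + 1 + k] factors. *)
Lemma hook_content_prod n k x :
  \prod_(r < k.+1) \prod_(c < nth 0%N (n.+1 :: nseq k 1%N) r)
    ((x%:R + content r c) / (hook (n.+1 :: nseq k 1%N) r c)%:R)
  = ('C(x + n, n.+1 + k) * 'C(n + k, k))%:R.
Proof.
have numE : \prod_(r < k.+1) \prod_(c < nth 0%N (n.+1 :: nseq k 1%N) r)
    (x%:R + content r c) = ((x + n) ^_ (n.+1 + k))%:R.
  rewrite natr_ffact big_split_ord big_ord_recl /=; congr (_ * _).
    rewrite (reindex_inj rev_ord_inj); apply: eq_bigr => c _ /=.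
    rewrite subSS /content subr0 natrB -1?ltnS // natrD; ring.
  apply: eq_bigr => r _; rewrite -[bump 0 r]/(r.+1) /= nth_nseq ltn_ord big_ord1 /content.
  rewrite !natrD -!natr1 /=; ring.
have hookE : \prod_(r < k.+1) \prod_(c < nth 0%N (n.+1 :: nseq k 1%N) r)
    (hook (n.+1 :: nseq k 1%N) r c)%:R = ((n.+1 + k) * n`! * k`!)%:R :> algC.
  rewrite big_ord_recl /= 2!natrM; congr (_ * _).
    rewrite big_ord_recl -natr_prod; congr (_%:R * _%:R).
      by rewrite /hook /arm /leg /= drop0 count_nseq mul1n subSS subn0.
    rewrite -ffactnn ffact_prod; apply: eq_bigr => c _.
    rewrite !lift0 /hook /arm /leg /= drop0 count_nseq mul0n addn0 subSS.
    by rewrite -subSn // subSS.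
  rewrite -ffactnn ffact_prod natr_prod; apply: eq_bigr => r _.
  rewrite -[bump 0 r]/(r.+1) /= nth_nseq ltn_ord big_ord1 /hook /arm /leg /=.
  by rewrite nth_nseq ltn_ord drop_nseq count_nseq mul1n subSS add0n -subSn.
under eq_bigr => r _ do rewrite prodf_div.
rewrite prodf_div numE hookE.
have nz : ((n.+1 + k) * n`! * k`!)%:R != 0 :> algC.
  by rewrite pnatr_eq0 -lt0n !muln_gt0 !fact_gt0.
apply: (mulIf nz); rewrite divfK // -natrM; congr _%:R.
rewrite -bin_ffact -mulnA; congr (_ * _)%N.
have := bin_fact (leq_addl n k); rewrite addnK addSn factS => <-.
by rewrite !mulnA [in RHS]mulnC !mulnA; lia.
Qed.

Lemma frakc_hook d k m : (k < d)%N -> (m <= d)%N ->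
  frakc (hook_part d k) m = 'C(d - k - 1, d - m)%:R * 'C(d.-1, k)%:R.
Proof.
move=> ltkd lemd; rewrite /frakc /hook_part.
have Ed : (d - k = (d - k - 1).+1)%N by lia.
set n := (d - k - 1)%N in Ed *; rewrite Ed big_mkord /= size_nseq.
have dE : (n.+1 + k = d)%N by lia.
have d1E : (n + k = d.-1)%N by lia.
rewrite -(sum_sign_bin n lemd) mulr_suml; apply: eq_bigr => l _.
rewrite -natrB -1?ltnS // hook_content_prod dE d1E natrM mulrA; congr (_ * _ * _).
Qed.

(** * Summation over partitions *)

Lemma hook_part_partition d k : (k < d)%N -> is_partition d (hook_part d k).
Proof.
move=> ltkd; apply/and3P; split.
- rewrite /= /hook_part; case: (k) ltkd => [|n] //= ltn; rewrite subn_gt0 ltn /=.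
  by elim: n {ltn} => //= n ->.
- by rewrite inE negb_or mem_nseq andbF andbT eq_sym -lt0n subn_gt0.
- by rewrite /= sumn_nseq mul1n subnK // ltnW.
Qed.

Lemma sum_partitions_hooks d (F : seq nat -> algC) :
    (forall la, is_partition d la ->
       (forall k, (k < d)%N -> la != hook_part d k) -> F la = 0) ->
  \sum_(la <- partitions d) F la = \sum_(0 <= k < d) F (hook_part d k).
Proof.
move=> F0; pose hooks := [seq hook_part d k | k <- iota 0 d].
rewrite (bigID (mem hooks)) /= [X in _ + X]big1_seq ?addr0 => [|la /andP[no_hook]].
  rewrite -big_filter (perm_big hooks) /=; first by rewrite big_map /index_iota subn0.
  apply: uniq_perm; first by rewrite filter_uniq ?uniq_partitions.
    rewrite map_inj_in_uniq ?iota_uniq // => k l _ _ [_ /(congr1 size)].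
    by rewrite !size_nseq.
  move=> la; rewrite mem_filter mem_partitions andb_idr // => /mapP[k].
  by rewrite mem_iota => /andP[_ ltkd] ->; apply: hook_part_partition.
rewrite mem_partitions => /F0; apply=> k ltkd.
by apply: contraNneq no_hook => ->; rewrite map_f // mem_iota.
Qed.

Unset Implicit Arguments.

Theorem theorem5p4 (d d' m i j : nat)
    (hd : (1 <= d)%N) (hd' : (1 <= d')%N)
    (hm : (1 <= m)%N && (m <= d)%N)
    (hi : (1 <= i)%N && (i <= d')%N)
    (hj : (1 <= j)%N && (j <= d)%N) :
  Wtilde d m (one_big_part d' i) [:: d] (one_big_part d j) =
    #|cycle_class d (one_big_part d j)|%:R
      * (d%:R : algC) ^ (d'%:Z - i%:Z - 1) / m`!%:R *
    \sum_(0 <= k < d)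
      (-1) ^+ k
      * ((d%:R - k%:R - 2%:R^-1) ^+ i - (- k%:R - 2%:R^-1) ^+ i)
      * (gbinom (d%:R - j%:R - 1) k%:Z
         + (-1) ^+ j.+1 * gbinom (d%:R - j%:R - 1) (k%:Z - j%:Z))
      * 'C(d - k - 1, d - m)%:R.
Proof.
have [s cs] := full_cycle_exists hd.
have crep : repr (cycle_class d [:: d]) \in cycle_class d [:: d] := mem_repr _ cs.
set beta := one_big_part d j.
(* An empty class would make [chi] meaningless, but both sides carry its size. *)
have [b0|[t ct]] := set_0Vmem (cycle_class d beta).
  rewrite /Wtilde b0 cards0 mul0r !mul0r big1 ?mulr0 // => la _.
  by rewrite mulr0 !mul0r mulr0 mul0r.
have brep : repr (cycle_class d beta) \in cycle_class d beta := mem_repr _ ct.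
rewrite /Wtilde sum_partitions_hooks => [|la part_la nohook]; last first.
  rewrite {1}/chi nonhook_char_full_cycle // ?mulr0 ?mul0r ?mulr0 ?mul0r // => k ltkd.
  by apply: contraNeq (nohook k ltkd) => /(hook_constituent part_la ltkd) ->.
case/andP: hm => m0 lemd; case/andP: hi => i0 leid.
have nzd : d%:R != 0 :> algC by rewrite pnatr_eq0 -lt0n.
have nzm : m`!%:R != 0 :> algC by rewrite pnatr_eq0 -lt0n fact_gt0.
have nzc : #|cycle_class d [:: d]|%:R != 0 :> algC.
  by rewrite pnatr_eq0 -lt0n; apply/card_gt0P; exists s.
have -> : (d%:R : algC) ^ (d'%:Z - i%:Z - 1) = d%:R ^+ (d' - i) / d%:R.
  by rewrite subzn // expfzDr // exprN1.
rewrite -(card_full_cycles hd) natrM !mulr_sumr.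
rewrite [LHS]big_seq_cond [RHS]big_seq_cond; apply: eq_bigr => k.
rewrite andbT mem_index_iota => /andP[_ ltkd].
rewrite prod_p_hook // p_hook // frakc_hook // /dim_irr hook_char1 //.
rewrite {1}/chi hook_char_full_cycle // /chi (hook_char_value ltkd hj) //.
have nzb : 'C(d.-1, k)%:R != 0 :> algC.
  by rewrite pnatr_eq0 -lt0n bin_gt0 -ltnS prednK.
by field; rewrite nzm nzd nzb nzc.
Qed.
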